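(* Let $k\ge2$, let $P(\lambda)=\sum_{i=0}^kA_i\lambda^i\in\mathbb F[\lambda]^{n\times n}$ be a matrix polynomial of grade $k$, and let $$L_P(\lambda)=M_{\boldsymbol\ell_q,\boldsymbol\ell_z}(\mathcal X,\mathcal Z)(\lambda M^P_{\mathbf z}-M^P_{\mathbf q})M_{\mathbf r_z,\mathbf r_q}(\mathcal W,\mathcal Y)$$ be a generalized Fiedler pencil with repetition (GFPR) associated with $P(\lambda)$. Then there exist block-permutation matrices $\Pi^n_{\boldsymbol\ell},\Pi^n_{\mathbf r}$ such that $$(\Pi^n_{\boldsymbol\ell})^{\mathcal B}L_P(\lambda)\Pi^n_{\mathbf r}=\begin{bmatrix}M(\lambda)&K_2(\lambda)^T\\ K_1(\lambda)&0\end{bmatrix}$$ is an extended $(\mathfrak h(\mathbf q)+\mathfrak h(k+\mathbf z)-2,\;n,\;\mathfrak h(\mathrm{rev}(\mathbf q))+\mathfrak h(\mathrm{rev}(k+\mathbf z))-2,\;n)$-block Kronecker pencil whose body $M(\lambda)$ satisfies the AS condition for $P(\lambda)$. Moreover, if $K_1(\lambda)$ and $K_2(\lambda)$ are minimal bases, then $(\Pi^n_{\boldsymbol\ell})^{\mathcal B}L_P(\lambda)\Pi^n_{\mathbf r}$ is a strong linearization of $P(\lambda)$.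
   Context: Basic notation. $\mathbb F$ is an arbitrary field; a matrix polynomial has grade $k$ if it is written $\sum_{i=0}^kA_i\lambda^i$ ($A_k=0$ allowed); a pencil is a matrix polynomial of grade 1. $a:b$ denotes $a,a+1,\dots,b$ if $a\le b$ and is empty otherwise. All block-matrices are partitioned into $n\times n$ blocks; $H^{\mathcal B}$ is the block-matrix whose $(i,j)$ block is $H_{ji}$. $\Lambda_s(\lambda)=[\lambda^s\ \lambda^{s-1}\ \cdots\ \lambda\ 1]$. For a permutation $\mathbf c$ of $\{1:k\}$, $\Pi^n_{\mathbf c}$ is the $k\times k$ block-matrix with $I_n$ in block positions $(c_i,i)$ and $0$ elsewhere. Elementary matrices ($kn\times kn$). $M_0(B)=I_{(k-1)n}\oplus B$; $M_{-k}(B)=B\oplus I_{(k-1)n}$; for $i=1:k-1$, $M_i(B)=I_{(k-i-1)n}\oplus\begin{bmatrix}B&I_n\\ I_n&0\end{bmatrix}\oplus I_{(i-1)n}$ and $M_{-i}(B)=I_{(k-i-1)n}\oplus\begin{bmatrix}0&I_n\\ I_n&B\end{bmatrix}\oplus I_{(i-1)n}$. $M_i^P=M_i(-A_i)$ for $i=0:k-1$; $M_{-i}^P=M_{-i}(A_i)$ for $i=1:k$; $M^P_{(t_1,\dots,t_r)}=M^P_{t_1}\cdots M^P_{t_r}$. A matrix assignment for a tuple $\mathbf t=(t_1,\dots,t_r)$ is an ordered list $\mathcal X=(X_1,\dots,X_r)$ of arbitrary $n\times n$ matrices, and $M_{\mathbf t}(\mathcal X)=M_{t_1}(X_1)\cdots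 M_{t_r}(X_r)$; empty products are identities. $M_{\mathbf t_1,\mathbf t_2}(\mathcal X_1,\mathcal X_2)=M_{\mathbf t_1}(\mathcal X_1)M_{\mathbf t_2}(\mathcal X_2)$. Index tuples. $\mathrm{rev}(\mathbf t)$ is the reversed tuple; $a+\mathbf t$ is entrywise; $(\mathbf t_1,\mathbf t_2)$ is concatenation. A tuple $(i_1,\dots,i_r)$ of only nonnegative or only negative integers satisfies the SIP if whenever $i_a=i_b$, $a<b$, there is $c$ with $a<c<b$ and $i_c=i_a+1$. Two tuples of nonnegative integers are equivalent if one is obtained from the other by finitely many interchanges of adjacent distinct indices $s,t$ with $|s-t|\ne1$. Each tuple $\mathbf t$ of nonnegative integers satisfying the SIP is equivalent to a unique tuple in column standard form $(a_s:b_s,\dots,a_1:b_1)$, $b_s>\dots>b_1\ge0$, $0\le a_j\le b_j$; then $\mathfrak h(\mathbf t)=s$ is the number of strings (the cardinality of $\mathrm{heads}(\mathbf t)=\{b_1,\dots,b_s\}$). GFPR. Let $h\in\{0:k-1\}$, let $\mathbf q,\mathbf z$ be permutations of $\{0:h\}$ and $\{-k:-h-1\}$; let $\boldsymbol\ell_q,\mathbf r_q$ be tuples with indices from $\{0:h-1\}$ such that $(\boldsymbol\ell_q,\mathbf q,\mathbf r_q)$ satisfies the SIP; let $\boldsymbol\ell_z,\mathbf r_z$ be tuples with indices from $\{-k:-h-2\}$ such that $(\boldsymbol\ell_z,\mathbf z,\mathbf r_z)$ satisfies the SIP; let $\mathcal X,\mathcal Y,\mathcal Z,\mathcal W$ be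 matrix assignments for $\boldsymbol\ell_q,\mathbf r_q,\boldsymbol\ell_z,\mathbf r_z$. Then $M_{\boldsymbol\ell_q,\boldsymbol\ell_z}(\mathcal X,\mathcal Z)(\lambda M^P_{\mathbf z}-M^P_{\mathbf q})M_{\mathbf r_z,\mathbf r_q}(\mathcal W,\mathcal Y)$ is a GFPR associated with $P(\lambda)$. Extended block Kronecker pencils. An $(s,n)$-wing pencil is a pencil $K(\lambda)\in\mathbb F[\lambda]^{sn\times(s+1)n}$ with $K(\lambda)(\Lambda_s(\lambda)^T\otimes I_n)=0$. An extended $(p,n,q,n)$-block Kronecker pencil is a pencil $\begin{bmatrix}M(\lambda)&K_2(\lambda)^T\\ K_1(\lambda)&0\end{bmatrix}$ with $K_1$ a $(p,n)$-wing pencil, $K_2$ a $(q,n)$-wing pencil, and $M(\lambda)$ (the body) an arbitrary $(q+1)n\times(p+1)n$ pencil; $p=0$ or $q=0$ (blocks absent) is allowed. AS condition. For a pencil $M(\lambda)=\lambda M_1+M_0\in\mathbb F[\lambda]^{(q+1)n\times(p+1)n}$ with $k=p+q+1$, put $\mathrm{AS}(M,s)=\sum_{i+j=k+2-s}[M_1]_{ij}+\sum_{i+j=k+1-s}[M_0]_{ij}$ (sums over $n\times n$ blocks). $M(\lambda)$ satisfies the AS condition for $P(\lambda)$ if $\mathrm{AS}(M,s)=A_s$ for $s=0:k$. Minimal basis. An $m\times q$ matrix polynomial ($m\le q$) is a minimal basis if its rows form a basis of the $\mathbb F(\lambda)$-subspace they span having the least sum of row degrees among all polynomial bases of that subspace.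 Strong linearization. A pencil $L(\lambda)$ is a linearization of $P(\lambda)$ of grade $k$ if for some $s\ge0$ there are unimodular $U,V$ with $U(\lambda)L(\lambda)V(\lambda)=\mathrm{diag}(I_s,P(\lambda))$; it is strong if also $\mathrm{rev}_1L(\lambda)=\lambda L(\lambda^{-1})$ is a linearization of $\mathrm{rev}_kP(\lambda)=\lambda^kP(\lambda^{-1})$. *)

(* Defs.v *)
From HB Require Import structures.
From mathcomp Require Import all_boot all_order all_fingroup all_algebra.
From Stdlib Require Import ClassicalEpsilon.

Set Implicit Arguments.
Unset Strict Implicit.
Unset Printing Implicit Defensive.

Import Order.TTheory GRing.Theory Num.Theory.
Local Open Scope ring_scope.

(* A block-matrix with a x b blocks, each of size n x n, over R is an element
   of 'M['M[R]_n]_(a, b).  The product *m of such matrices (over the ring of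
   n x n matrices) is the block product, and the transpose ^T only permutes
   the blocks: it is the block-transpose H |-> H^B.  Row and column indices
   start at 0, so that the block called (i, j) on paper is (i - 1, j - 1). *)

Definition flatten_mx (R : Type) (a b n : nat) (H : 'M['M[R]_n]_(a, b)) :
    'M[R]_(\sum_(i < a) n, \sum_(j < b) n) :=
  \mxblock_(i < a, j < b) H i j.

(* The transpose of the flattened matrix, as a block-matrix. *)
Definition full_tr (R : Type) (a b n : nat) (H : 'M['M[R]_n]_(a, b)) :
    'M['M[R]_n]_(b, a) :=
  \matrix_(i < b, j < a) (H j i)^T.

(* Pi^n_c has I_n in the positions (c_i, i). *)
Definition block_perm (R : pzRingType) (k n : nat) (c : 'S_k) :
    'M['M[R]_n]_k :=
  \matrix_(i < k, j < k) (i == c j)%:R.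

Section PolynomialMatrices.
Variable F : fieldType.

Definition has_grade (d a b : nat) (A : 'M[{poly F}]_(a, b)) : Prop :=
  forall i j, (size (A i j) <= d.+1)%N.

Definition coef_mx (s a b : nat) (A : 'M[{poly F}]_(a, b)) : 'M[F]_(a, b) :=
  map_mx (coefp s) A.

Definition rev_mx (d a b : nat) (A : 'M[{poly F}]_(a, b)) :
    'M[{poly F}]_(a, b) :=
  map_mx (fun f : {poly F} => \poly_(i < d.+1) f`_(d - i)) A.

(* unitmx over F[lambda] is unimodularity. *)
Definition is_linearization (N n : nat) (L : 'M[{poly F}]_N)
    (P : 'M[{poly F}]_n) : Prop :=
  has_grade 1 L /\
  exists (s : nat) (e : N = (s + n)%N) (U V : 'M[{poly F}]_N),
    [/\ U \in unitmx, V \in unitmx &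
        castmx (e, e) (U *m L *m V) = block_mx 1%:M 0 0 P].

Definition is_strong_linearization (k N n : nat) (L : 'M[{poly F}]_N)
    (P : 'M[{poly F}]_n) : Prop :=
  is_linearization L P /\ is_linearization (rev_mx 1 L) (rev_mx k P).

Definition row_degree (a b : nat) (K : 'M[{poly F}]_(a, b)) (i : 'I_a) : nat :=
  \max_(j < b) (size (K i j)).-1.

Definition frac_mx (a b : nat) (K : 'M[{poly F}]_(a, b)) :
    'M[{fraction {poly F}}]_(a, b) :=
  map_mx (@tofrac _) K.

Definition is_minimal_basis (a b : nat) (K : 'M[{poly F}]_(a, b)) : Prop :=
  row_free (frac_mx K) /\
  forall N : 'M[{poly F}]_(a, b),
    row_free (frac_mx N) -> (frac_mx N :=: frac_mx K)%MS ->
    (\sum_(i < a) row_degree K i <= \sum_(i < a) row_degree N i)%N.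

Definition const_blocks (a b n : nat) (H : 'M['M[F]_n]_(a, b)) :
    'M['M[{poly F}]_n]_(a, b) :=
  map_mx (map_mx polyC) H.

Definition is_block_pencil (a b n : nat) (H : 'M['M[{poly F}]_n]_(a, b)) :
    Prop :=
  has_grade 1 (flatten_mx H).

(* Lambda_s(lambda)^T (x) I_n *)
Definition Lambda_col (s n : nat) : 'cV['M[{poly F}]_n]_s.+1 :=
  \col_(j < s.+1) ('X^(s - j))%:M.

Definition is_wing_pencil (s n : nat) (K : 'M['M[{poly F}]_n]_(s, s.+1)) :
    Prop :=
  is_block_pencil K /\ K *m Lambda_col s n = 0.

Definition is_ext_block_kronecker (p q n : nat)
    (C : 'M['M[{poly F}]_n]_(q.+1 + p, p.+1 + q))
    (M : 'M['M[{poly F}]_n]_(q.+1, p.+1))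
    (K1 : 'M['M[{poly F}]_n]_(p, p.+1))
    (K2 : 'M['M[{poly F}]_n]_(q, q.+1)) : Prop :=
  [/\ C = block_mx M (full_tr K2) K1 0,
      is_block_pencil M, is_wing_pencil K1 & is_wing_pencil K2].

(* i.+1 and j.+1 are the usual block indices, counted from 1. *)
Definition AS (p q n : nat) (M : 'M['M[{poly F}]_n]_(q.+1, p.+1)) (s : nat) :
    'M[F]_n :=
  let k := (p + q + 1)%N in
  \sum_(i < q.+1) \sum_(j < p.+1 | (i.+1 + j.+1 + s == k + 2)%N)
     coef_mx 1 (M i j) +
  \sum_(i < q.+1) \sum_(j < p.+1 | (i.+1 + j.+1 + s == k + 1)%N)
     coef_mx 0 (M i j).

Definition AS_condition (p q n : nat) (M : 'M['M[{poly F}]_n]_(q.+1, p.+1))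
    (P : 'M[{poly F}]_n) : Prop :=
  forall s, (s <= p + q + 1)%N -> AS M s = coef_mx s P.

(* [B11 B12; B21 B22] placed on the block rows and columns r, r + 1 (counted
   from 0) of the identity. *)
Definition core2 (k n r : nat) (B11 B12 B21 B22 : 'M[F]_n) :
    'M['M[F]_n]_k :=
  \matrix_(i < k, j < k)
    if (i == r :> nat) && (j == r :> nat) then B11
    else if (i == r :> nat) && (j == r.+1 :> nat) then B12
    else if (i == r.+1 :> nat) && (j == r :> nat) then B21
    else if (i == r.+1 :> nat) && (j == r.+1 :> nat) then B22
    else if i == j then 1%:M else 0.

(* The block-diagonal matrix diag(I, ..., I, B, I, ..., I), B in position r. *)
Definition core1 (k n r : nat) (B : 'M[F]_n) : 'M['M[F]_n]_k :=
  \matrix_(i < k, j < k)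
    if i == j then (if i == r :> nat then B else 1%:M) else 0.

(* M_t(B) for t in {-k : k-1}; the value for other t is irrelevant. *)
Definition elem_mx (k n : nat) (t : int) (B : 'M[F]_n) : 'M['M[F]_n]_k :=
  if t == 0 then core1 k k.-1 B
  else if t == - (k%:Z) then core1 k 0 B
  else if 0 < t then core2 k (k - `|t| - 1) B 1%:M 1%:M 0
  else core2 k (k - `|t| - 1) 0 1%:M 1%:M B.

Definition elem_mxP (k n : nat) (P : 'M[{poly F}]_n) (t : int) :
    'M['M[F]_n]_k :=
  elem_mx k t (if 0 <= t then - coef_mx `|t| P else coef_mx `|t| P).

Definition tuple_mxP (k n : nat) (P : 'M[{poly F}]_n) (t : seq int) :
    'M['M[F]_n]_k :=
  \prod_(i <- t) elem_mxP k P i.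

(* M_t(X); used with size X = size t. *)
Definition tuple_mx (k n : nat) (t : seq int) (X : seq 'M[F]_n) :
    'M['M[F]_n]_k :=
  \prod_(tX <- zip t X) elem_mx k tX.1 tX.2.

Definition gfpr (k n : nat) (P : 'M[{poly F}]_n)
    (lq lz z q rz rq : seq int) (X Z W Y : seq 'M[F]_n) :
    'M['M[{poly F}]_n]_k :=
  const_blocks (tuple_mx k lq X *m tuple_mx k lz Z)
  *m ('X%:M *: const_blocks (tuple_mxP k P z) - const_blocks (tuple_mxP k P q))
  *m const_blocks (tuple_mx k rz W *m tuple_mx k rq Y).

End PolynomialMatrices.

(* a:b *)
Definition colon (a b : int) : seq int :=
  if a <= b then [seq a + i%:Z | i <- iota 0 `|b - a|.+1] else [::].

Definition SIP (t : seq int) : Prop :=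
  forall a b : nat, (a < b < size t)%N -> t`_a = t`_b ->
    exists c : nat, (a < c < b)%N /\ t`_c = t`_a + 1.

Inductive tuple_equiv : seq int -> seq int -> Prop :=
| tuple_equiv_refl t : tuple_equiv t t
| tuple_equiv_swap t1 t2 (x y : int) u :
    x != y -> `|x - y| != 1 ->
    tuple_equiv (t1 ++ y :: x :: t2) u ->
    tuple_equiv (t1 ++ x :: y :: t2) u.

(* st lists the pairs (a_s, b_s), ..., (a_1, b_1) of a tuple in column standard
   form (a_s:b_s, ..., a_1:b_1). *)
Definition is_csf (st : seq (int * int)) : bool :=
  all (fun ab => 0 <= ab.1 <= ab.2) st &&
  sorted (fun x y : int => y < x) [seq ab.2 | ab <- st].

Definition csf_tuple (st : seq (int * int)) : seq int :=
  flatten [seq colon ab.1 ab.2 | ab <- st].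

Definition has_strings (t : seq int) (s : nat) : Prop :=
  exists st : seq (int * int),
    [/\ is_csf st, tuple_equiv t (csf_tuple st) & size st = s].

(* The number of strings of the column standard form of t; it is well defined
   for tuples of nonnegative integers satisfying the SIP. *)
Definition nb_strings (t : seq int) : nat :=
  epsilon (inhabits 0%N) (has_strings t).

Definition shift_tuple (a : int) (t : seq int) : seq int :=
  [seq a + i | i <- t].

(* Main.v *)
Require Import Defs.
From HB Require Import structures.
From mathcomp Require Import all_boot all_order all_fingroup all_algebra zify.
From Stdlib Require Import ClassicalEpsilon.
Set Implicit Arguments.
Unset Strict Implicit.
Unset Printing Implicit Defensive.
Import Order.TTheory GRing.Theory Num.Theory.
Local Open Scope ring_scope.

(** The obstacle to the splitting is that each of M_z and M_q is the identity where the other one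
    acts, so neither summand of the pencil has the required structure. The remedy is a diagonal
    matrix D with lambda at the positions of q alone, 1 at those of z alone and 0 at the one
    position they share. Both D - M_q and D - lambda M_z vanish outside their own positions, and D
    cancels in their difference.

    The sizes come from the order of neighbours. If j, j + 1 are consecutive indices of q (or of k +
    z), exactly one of the row and the column at the position of j enters the body: the row if j
    comes first, the column if j + 1 does. In the column standard form a new string starts exactly
    when j + 1 comes before j, so strings count selected columns, and strings of the reversed tuple
    count selected rows. The same alternation makes the row and column exponents at the position of
    a coefficient A_i add up to the power that yields lambda^i.

    Repetition factors only permute the selected rows and columns, hence change neither the sizes
    nor w L v. *)

(* Up to a permutation of block rows and columns, L is an extended block
   Kronecker pencil whose body satisfies the AS condition if and only if there
   are block vectors w and v, whose nonzero blocks are the powers 1, lambda, ... of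
   lambda, each occurring once, such that L v vanishes on the rows where w does,
   w L vanishes on the columns where v does, the blocks of L at the intersections
   of these rows and columns are 0, and w L v = P.  These four conditions are
   additive in L, so that lambda M_z - M_q can be split into a part depending on z
   and one depending on q, each treated by induction on the number of elementary
   factors.  An elementary matrix exchanges two block columns and adds a multiple of
   one of them to the other; the four conditions survive if v vanishes on the added
   column, and the SIP says exactly that this is the case for every repeated index.

   A wing pencil is N (L_p (x) I_n) with N constant; if it is a minimal basis, N
   is invertible, and the block Kronecker pencil is reduced to diag(I, P) by
   explicit unimodular matrices.  Reversing the order of the block rows and columns
   of the body turns the reversal of the pencil into one of the same kind. *)

(** * Column standard form of a permutation *)

(** With repetitions this compares first occurrences; an accumulated word whose last occurrences
    matter is therefore kept in reversed order below. *)
Definition before (T : eqType) (t : seq T) (x y : T) : bool :=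
  (index x t < index y t)%N.

Lemma before_remove (T : eqType) (x y z : T) (t1 t2 : seq T) :
  x != z -> y != z -> before (t1 ++ z :: t2) x y = before (t1 ++ t2) x y.
Proof.
move=> xz yz; rewrite /before !index_cat /= ![z == _]eq_sym.
rewrite (negPf xz) (negPf yz); have := index_mem x t1; have := index_mem y t1.
by case: ifP; case: ifP => _ _ H1 H2; lia.
Qed.

Lemma before_map (T U : eqType) (f : T -> U) (t : seq T) (x y : T) :
  injective f -> before (map f t) (f x) (f y) = before t x y.
Proof. by move=> fI; rewrite /before !index_map. Qed.

Lemma index_rev_uniq (T : eqType) (t : seq T) (x : T) : uniq t -> x \in t ->
  index x (rev t) = (size t - (index x t).+1)%N.
Proof.
move=> Ut xt; have lt : (index x t < size t)%N by rewrite index_mem.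
rewrite -{1}(nth_index x xt).
have -> : nth x t (index x t) = nth x (rev t) (size t - (index x t).+1).
  by rewrite nth_rev; [congr nth; lia | lia].
by rewrite index_uniq ?rev_uniq ?size_rev //; lia.
Qed.

Lemma before_rev (T : eqType) (t : seq T) (x y : T) :
  uniq t -> x \in t -> y \in t -> before (rev t) x y = before t y x.
Proof.
move=> Ut xt yt; rewrite /before !index_rev_uniq //.
by move: xt yt; rewrite -!index_mem; lia.
Qed.

Lemma beforeN (T : eqType) (t : seq T) (x y : T) :
  x != y -> x \in t -> before t x y = ~~ before t y x.
Proof.
move=> xy xt; rewrite /before -leqNgt [RHS]leq_eqVlt.
case: eqP => //= ii; have yt : y \in t by rewrite -index_mem -ii index_mem.
by move: xy; rewrite -(nth_index x xt) ii nth_index ?eqxx.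
Qed.

Lemma tuple_equiv_trans (t u v : seq int) :
  tuple_equiv t u -> tuple_equiv u v -> tuple_equiv t v.
Proof.
elim=> // t1 t2 x y w xy d _ IH wv.
by apply: tuple_equiv_swap => //; apply: IH.
Qed.

Lemma tuple_equiv_sym (t u : seq int) : tuple_equiv t u -> tuple_equiv u t.
Proof.
elim=> [v|t1 t2 x y w xy d _ IH]; first exact: tuple_equiv_refl.
apply: (tuple_equiv_trans IH); apply: tuple_equiv_swap.
- by rewrite eq_sym.
- by rewrite distrC.
- exact: tuple_equiv_refl.
Qed.

Lemma tuple_equiv_cat (s t u v : seq int) :
  tuple_equiv t u -> tuple_equiv (s ++ t ++ v) (s ++ u ++ v).
Proof.
elim=> [w|t1 t2 x y w xy d _ IH]; first exact: tuple_equiv_refl.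
rewrite -catA /= catA; apply: tuple_equiv_swap => //.
by move: IH; rewrite -catA /= -catA.
Qed.

Lemma tuple_equiv_move (x : nat) (t u v : seq nat) :
  all (fun y => y.+1 < x)%N t ->
  tuple_equiv (map Posz (u ++ x :: t ++ v)) (map Posz (u ++ t ++ x :: v)).
Proof.
elim: t u => [|y t IH] u /=; first by move=> _; exact: tuple_equiv_refl.
case/andP=> yx /IH {}IH; rewrite map_cat /=; apply: tuple_equiv_swap.
- by apply/eqP => -[]; lia.
- by lia.
- by have := IH (rcons u y); rewrite -!cats1 -!catA /= map_cat.
Qed.

(** Interchanged entries never differ by 1, so the relative order of [j] and [j + 1] is an invariant
    of the equivalence class. *)
Lemma tuple_equiv_inv (t u : seq int) : tuple_equiv t u ->
  perm_eq t u /\ forall j, before t (j + 1) j = before u (j + 1) j.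
Proof.
elim=> // t1 t2 x y w xy d _ [pe IH]; split.
  apply: perm_trans pe; rewrite perm_cat2l.
  by rewrite -[x :: _]/([:: x] ++ [:: y] ++ t2) perm_catCA.
move=> j; rewrite -IH.
have [jx|jx] := boolP ((j != x) && (j + 1 != x)).
  case/andP: jx => j1 j2; rewrite before_remove //.
  by rewrite -[in RHS]cat_rcons [RHS]before_remove // cat_rcons.
have j1 : j != y by apply/eqP => e; move: jx xy d; lia.
have j2 : j + 1 != y by apply/eqP => e; move: jx xy d; lia.
by rewrite -[in LHS]cat_rcons before_remove // cat_rcons [RHS]before_remove.
Qed.

(** In the language of Fiedler pencils, [ndesc] is the number of inversions of the permutation and
    [nasc] its number of consecutions. *)
Definition ndesc (h : nat) (t : seq nat) : nat :=
  count (fun j => before t j.+1 j) (iota 0 h).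

Definition nasc (h : nat) (t : seq nat) : nat :=
  count (fun j => before t j j.+1) (iota 0 h).

Lemma perm_iota_top (h : nat) (t1 t2 : seq nat) :
  perm_eq (t1 ++ h.+1 :: t2) (iota 0 h.+2) = perm_eq (t1 ++ t2) (iota 0 h.+1).
Proof.
rewrite -(addn1 h.+1) iotaD perm_sym perm_catC perm_sym.
by rewrite -[h.+1 :: t2]/([:: h.+1] ++ t2) perm_catCA perm_cons.
Qed.

Lemma perm_iota_split (h : nat) (t : seq nat) : perm_eq t (iota 0 h.+2) ->
  exists t1 t2, t = t1 ++ h.+1 :: t2 /\ perm_eq (t1 ++ t2) (iota 0 h.+1).
Proof.
move=> pt; have ht : h.+1 \in t by rewrite (perm_mem pt) mem_iota; lia.
case/splitPr: t / ht pt => t1 t2 pt; exists t1, t2.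
by rewrite -perm_iota_top.
Qed.

Lemma ndescS_split (h : nat) (t1 t2 : seq nat) :
  ndesc h.+1 (t1 ++ h.+1 :: t2) =
  (ndesc h (t1 ++ t2) + before (t1 ++ h.+1 :: t2) h.+1 h)%N.
Proof.
rewrite /ndesc -[X in iota 0 X]addn1 iotaD count_cat /= addn0 add0n; congr (_ + _)%N.
by apply: eq_in_count => j; rewrite mem_iota => jh; rewrite before_remove //; lia.
Qed.

Definition csf_nat (st : seq (nat * nat)) : bool :=
  all (fun ab => ab.1 <= ab.2)%N st && sorted gtn (unzip2 st).

Definition tuple_nat (st : seq (nat * nat)) : seq nat :=
  flatten [seq iota ab.1 (ab.2 - ab.1).+1 | ab <- st].

Lemma csf_nat_cons (a b : nat) (st : seq (nat * nat)) :
  csf_nat ((a, b) :: st) =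
  [&& a <= b, all (fun c => c < b)%N (unzip2 st) & csf_nat st]%N.
Proof.
rewrite /csf_nat /= path_sortedE; last by move=> x y z /=; lia.
by rewrite -!andbA; case: (a <= b)%N => //=; rewrite andbCA.
Qed.

Lemma head_tuple_nat (st : seq (nat * nat)) (c : nat) :
  csf_nat st -> c \in unzip2 st -> c \in tuple_nat st.
Proof.
elim: st => // -[a b] st IH; rewrite csf_nat_cons /= inE => /and3P[ab _ cst].
case/predU1P=> [->|/(IH cst) cin]; rewrite /tuple_nat /= inE !mem_cat.
  by rewrite mem_iota; apply/orP; lia.
by rewrite cin !orbT.
Qed.

(** Heads decrease strictly and bound their strings, so the largest index can only end the first
    string. *)
Lemma tuple_nat_head (st : seq (nat * nat)) (h : nat) :
  csf_nat st -> h \in tuple_nat st -> all (fun c => c <= h)%N (tuple_nat st) ->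
  exists a st', [/\ st = (a, h) :: st', (a <= h)%N & csf_nat st'].
Proof.
move=> cst hin /allP le_h; case: st => [//|[a b] st] in cst hin le_h *.
have /andP[/allP lest _] := cst.
have bh : (b <= h)%N by apply/le_h/head_tuple_nat => //; rewrite /= inE eqxx.
exists a, st; move: cst; rewrite csf_nat_cons => /and3P[ab bst cst].
suff -> : h = b by [].
apply/eqP; rewrite eqn_leq bh andbT; case/flattenP: hin => s /mapP[[a' b'] abin ->].
rewrite mem_iota /= => /andP[h1 h2].
suff : (b' <= b)%N by move: h1 h2 (lest _ abin) => /=; lia.
move: abin; rewrite inE => /predU1P[[_ ->//]|/(map_f snd) /(allP bst)].
by move/ltnW.
Qed.

Lemma tuple_nat_extend (a h : nat) (st : seq (nat * nat)) : (a <= h)%N ->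
  tuple_nat ((a, h.+1) :: st) = iota a (h - a).+1 ++ h.+1 :: tuple_nat st.
Proof.
move=> ah; rewrite /tuple_nat [in LHS]/= -[_ :: _ ++ _]/(iota a (h.+1 - a).+1 ++ _).
have -> : (h.+1 - a).+1 = ((h - a).+1 + 1)%N by lia.
by rewrite iotaD -catA /=; congr (_ :: _ ++ _ :: _); lia.
Qed.

(** Induction on the largest index [h.+1], which may pass every entry except [h]. If [h] is not on
    its left, it moves to the front and is a string of its own. Otherwise it moves to the end, the
    rest is put in standard form with a first string ending at [h], and [h.+1] moves back to extend
    that string. *)
Lemma csf_exists (h : nat) (t : seq nat) : perm_eq t (iota 0 h.+1) ->
  exists st, csf_nat st /\ tuple_equiv (map Posz t) (map Posz (tuple_nat st)).
Proof.
elim: h t => [|h IH] t.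
  move=> /perm_small_eq-> //; exists [:: (0, 0)]%N; split=> //.
  exact: tuple_equiv_refl.
case/perm_iota_split=> t1 [t2 [-> pt]].
have [st [cst eqv]] := IH _ pt.
have pst : perm_eq (tuple_nat st) (iota 0 h.+1).
  have [pe _] := tuple_equiv_inv eqv; apply: perm_trans pt; rewrite perm_sym.
  by apply: perm_map_inj pe => x y [].
have le_h : all (fun c => c <= h)%N (tuple_nat st).
  by apply/allP => c; rewrite (perm_mem pst) mem_iota; lia.
have Ut : uniq (t1 ++ t2) by rewrite (perm_uniq pt) iota_uniq.
have t_le c : c \in t1 ++ t2 -> (c <= h)%N.
  by rewrite (perm_mem pt) mem_iota; lia.
have [ht1|ht1] := boolP (h \in t1); last first.
  exists ((h.+1, h.+1) :: st); split.
    rewrite csf_nat_cons leqnn cst andbT /=.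
    by apply/allP => c /(head_tuple_nat cst) /(allP le_h).
  apply: (@tuple_equiv_trans _ (map Posz (h.+1 :: t1 ++ t2))).
    apply/tuple_equiv_sym/(@tuple_equiv_move h.+1 t1 [::]).
    apply/allP => y yt1; have := t_le y; rewrite mem_cat yt1 => /(_ isT).
    by have : y != h by [apply: contraNneq ht1 => <-]; lia.
  rewrite /tuple_nat /= subnn /=.
  by have := tuple_equiv_cat [:: h.+1%:Z] [::] eqv; rewrite !cats0.
have hin : h \in tuple_nat st by rewrite (perm_mem pst) mem_iota; lia.
have [a [st' [est ah cst']]] := tuple_nat_head cst hin le_h.
have Ust : uniq (tuple_nat st) by rewrite (perm_uniq pst) iota_uniq.
have est2 : tuple_nat st = iota a (h - a).+1 ++ tuple_nat st' by rewrite est.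
have hst' c : c \in tuple_nat st' -> (c < h)%N.
  move=> cin; have : (c <= h)%N by apply: (allP le_h); rewrite est2 mem_cat cin orbT.
  rewrite leq_eqVlt => /predU1P[ch|//]; move: Ust; rewrite est2 cat_uniq.
  case/and3P=> _ /hasPn /(_ _ cin) /negP[]; rewrite ch.
  by change (h \in iota a (h - a).+1); rewrite mem_iota; lia.
exists ((a, h.+1) :: st'); split.
  rewrite csf_nat_cons cst' andbT; apply/andP; split; first by lia.
  by apply/allP => c /(head_tuple_nat cst') /hst'; lia.
rewrite tuple_nat_extend //.
apply: (@tuple_equiv_trans _ (map Posz (t1 ++ t2 ++ [:: h.+1]))).
  rewrite -[X in h.+1 :: X]cats0; apply: tuple_equiv_move.
  apply/allP => y yt2; have := t_le y; rewrite mem_cat yt2 orbT => /(_ isT).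
  have : y != h; last by lia.
  apply: contraTneq yt2 => ->; move: Ut; rewrite cat_uniq => /and3P[_ /hasPn U _].
  by apply/negP => /U; rewrite /= ht1.
apply: (@tuple_equiv_trans _ (map Posz (tuple_nat st ++ [:: h.+1]))).
  by rewrite catA !(map_cat _ _ [:: h.+1]); exact: (tuple_equiv_cat [::] _ eqv).
rewrite est2 -catA; apply: tuple_equiv_sym.
rewrite -[X in h.+1 :: X]cats0; apply: tuple_equiv_move.
by apply/allP => c /hst'.
Qed.

(** The largest index either forms a string alone, and then precedes its predecessor, or extends the
    string that its predecessor ends; only the first case adds a string and a descent. *)
Lemma csf_size (h : nat) (st : seq (nat * nat)) : csf_nat st ->
  perm_eq (tuple_nat st) (iota 0 h.+1) -> size st = (ndesc h (tuple_nat st)).+1.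
Proof.
elim: h st => [|h IH] st cst pst.
  have := perm_size pst; case: st {cst pst} => [//|[a b] [//|[a' b'] st]].
  by rewrite /tuple_nat /= size_cat /= addnS.
have hin : h.+1 \in tuple_nat st by rewrite (perm_mem pst) mem_iota; lia.
have le_h : all (fun c => c <= h.+1)%N (tuple_nat st).
  by apply/allP => c; rewrite (perm_mem pst) mem_iota; lia.
have [a [st' [est ah cst']]] := tuple_nat_head cst hin le_h.
have rem_top t1 t2 : tuple_nat st = t1 ++ h.+1 :: t2 ->
  perm_eq (t1 ++ t2) (iota 0 h.+1).
  by move=> e; rewrite -perm_iota_top -e.
have [ah1|ah1] := eqVneq a h.+1.
  have e : tuple_nat st = [::] ++ h.+1 :: tuple_nat st'.
    by rewrite est ah1 /tuple_nat /= subnn.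
  rewrite e ndescS_split -addSn -IH //; last exact: (rem_top _ _ e).
  by rewrite est /= /before /= eqxx; case: eqP => //; lia.
have {}ah : (a <= h)%N by lia.
have e : tuple_nat st = iota a (h - a).+1 ++ h.+1 :: tuple_nat st'.
  by rewrite est tuple_nat_extend.
have p' := rem_top _ _ e.
have Ut := perm_uniq p'; rewrite iota_uniq cat_uniq in Ut.
have e' : iota a (h - a).+1 ++ tuple_nat st' = tuple_nat ((a, h) :: st') by [].
rewrite e ndescS_split e' -addSn -IH.
- have -> : size st = size ((a, h) :: st') by rewrite est.
  rewrite /before !index_cat !mem_iota.
  have -> : (a <= h.+1 < a + (h - a).+1)%N = false by lia.
  have -> : (a <= h < a + (h - a).+1)%N by lia.
  have := index_mem h (iota a (h - a).+1); rewrite mem_iota; lia.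
- rewrite csf_nat_cons ah cst' andbT /=; apply/allP => c.
  move/(head_tuple_nat cst') => cin.
  have : c \in iota a (h - a).+1 ++ tuple_nat st' by rewrite mem_cat cin orbT.
  rewrite (perm_mem p') mem_iota => ch; suff : c != h by lia.
  case/and3P: Ut => _ /hasPn /(_ _ cin) + _; apply: contraNneq => ->.
  by change (h \in iota a (h - a).+1); rewrite mem_iota; lia.
- by rewrite -e'.
Qed.

Lemma colonE (a b : nat) : (a <= b)%N ->
  colon a%:Z b%:Z = map Posz (iota a (b - a).+1).
Proof.
move=> ab; rewrite /colon ifT; last by lia.
have -> : `|b%:Z - a%:Z|%N = (b - a)%N by lia.
have -> m : iota a m = map (addn a) (iota 0 m) by rewrite -iotaDl addn0.
rewrite -!map_comp; apply: eq_map => i /=; lia.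
Qed.

Lemma csf_tupleE (st : seq (nat * nat)) : csf_nat st ->
  csf_tuple [seq (ab.1%:Z, ab.2%:Z) | ab <- st] = map Posz (tuple_nat st).
Proof.
rewrite /csf_nat => /andP[/allP ab _]; rewrite /csf_tuple /tuple_nat map_flatten.
congr flatten; rewrite -!map_comp; apply/eq_in_map => -[a b] /ab /= lab.
by rewrite colonE.
Qed.

Lemma is_csfE (st : seq (nat * nat)) :
  is_csf [seq (ab.1%:Z, ab.2%:Z) | ab <- st] = csf_nat st.
Proof.
by rewrite /is_csf /csf_nat all_map -!map_comp /unzip2 !sorted_map.
Qed.

(** [nb_strings] is chosen by [epsilon]: one standard form must be shown to exist, and every
    equivalent one must have the same number of strings. The latter holds because descents are
    invariant. *)
Lemma nb_stringsE (h : nat) (t : seq nat) : perm_eq t (iota 0 h.+1) ->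
  nb_strings (map Posz t) = (ndesc h t).+1.
Proof.
move=> pt; pose hs := has_strings (map Posz t).
have [s Hs] : exists s, hs s.
  have [st [cst eqv]] := csf_exists pt.
  exists (size st), [seq (ab.1%:Z, ab.2%:Z) | ab <- st].
  by rewrite is_csfE csf_tupleE // size_map.
have := epsilon_spec (inhabits 0%N) hs (ex_intro _ _ Hs).
rewrite -[epsilon _ _]/(nb_strings (map Posz t)); case=> st' [cst' eqv <-].
have [st est'] : exists st, st' = [seq (ab.1%:Z, ab.2%:Z) | ab <- st].
  exists [seq (`|ab.1|%N, `|ab.2|%N) | ab <- st'].
  rewrite -map_comp -[LHS]map_id; apply/eq_in_map => -[a b] /= ab.
  by case/andP: cst' => /allP /(_ _ ab) /= ? _; congr (_, _); lia.
rewrite est' is_csfE in cst'; rewrite est' csf_tupleE // in eqv.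
rewrite est' size_map.
have [pe ord] := tuple_equiv_inv eqv.
have {}pe : perm_eq t (tuple_nat st).
  by apply: perm_map_inj pe => x y [].
rewrite (@csf_size h) //; last by apply: perm_trans pt; rewrite perm_sym.
congr _.+1; apply: eq_count => j; have := ord j%:Z.
have -> : j%:Z + 1 = Posz j.+1 by lia.
by rewrite !before_map // => x y [].
Qed.

Lemma ndesc_rev (h : nat) (t : seq nat) : perm_eq t (iota 0 h.+1) ->
  ndesc h (rev t) = nasc h t.
Proof.
move=> pt; apply: eq_in_count => j; rewrite mem_iota => jh.
by rewrite before_rev ?(perm_uniq pt) ?iota_uniq // (perm_mem pt) mem_iota; lia.
Qed.

(** * Elementary matrices as modified transpositions *)

Lemma full_trK (R : Type) (a b n : nat) (H : 'M['M[R]_n]_(a, b)) :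
  full_tr (full_tr H) = H.
Proof. by apply/matrixP=> i j; rewrite !mxE trmxK. Qed.

Lemma full_tr_mul (R : comPzRingType) (a b c n : nat)
    (G : 'M['M[R]_n]_(a, b)) (H : 'M['M[R]_n]_(b, c)) :
  full_tr (G *m H) = full_tr H *m full_tr G.
Proof.
apply/matrixP=> i j; rewrite !mxE raddf_sum; apply: eq_bigr => l _.
by rewrite !mxE; exact: trmx_mul.
Qed.

Lemma full_tr1 (R : comPzRingType) (k n : nat) :
  full_tr (1%:M : 'M['M[R]_n]_k) = 1%:M.
Proof.
apply/matrixP=> i j; rewrite !mxE eq_sym.
by case: (i == j); rewrite ?trmx0 // -[1 *+ true]/(1%:M : 'M[R]_n) trmx1.
Qed.

(* The elementary matrices, positive and negative ones alike, are all of this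
   form: a transposition of two block columns, plus one block C at (a, a). *)
Definition swap_mx (A : pzRingType) (k : nat) (a b : 'I_k) (C : A) : 'M[A]_k :=
  \matrix_(i, j) ((i == tperm a b j)%:R + (if (i == a) && (j == a) then C else 0)).

Section SwapMatrices.
Variables (A : pzRingType) (k : nat).
Implicit Types (T : 'M[A]_k) (a b : 'I_k) (C : A).

Lemma mul_swap T a b C i j : (T *m swap_mx a b C) i j =
  T i (tperm a b j) + (if j == a then T i a * C else 0).
Proof.
rewrite mxE; under eq_bigr do rewrite mxE mulrDr; rewrite big_split /=.
congr (_ + _).
  rewrite (bigD1 (tperm a b j)) //= eqxx mulr1 big1 ?addr0 // => l /negPf->.
  by rewrite mulr0.
rewrite (bigD1 a) //= eqxx big1 ?addr0 => [|l /negPf->]; last by rewrite mulr0.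
by case: (j == a); rewrite ?mulr0.
Qed.

Lemma swap_out a b C i j :
  (i != a) && (i != b) || (j != a) && (j != b) -> swap_mx a b C i j = (i == j)%:R.
Proof.
rewrite !mxE; case: tpermP => [->|->|/eqP ja /eqP jb].
- by rewrite !eqxx /= orbF andbT => /andP[/negPf-> /negPf->]; rewrite addr0.
- rewrite eqxx andbF orbF => /andP[/negPf ia /negPf->].
  by rewrite ia addr0.
- by rewrite (negPf ja) andbF addr0.
Qed.

(** [X - 1] and [Y - 1] are supported on disjoint index sets, so their products in both orders
    vanish and both [X Y] and [Y X] equal [X + Y - 1]. *)
Lemma swap_mxC a b c d C D : a != c -> a != d -> b != c -> b != d ->
  swap_mx a b C *m swap_mx c d D = swap_mx c d D *m swap_mx a b C.
Proof.
move=> ac ad bc bd.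
have zero (X Y : 'M[A]_k) (P Q : pred 'I_k) : (forall l, ~~ (P l && Q l)) ->
    (forall i j, ~~ (P i && P j) -> X i j = (i == j)%:R) ->
    (forall i j, ~~ (Q i && Q j) -> Y i j = (i == j)%:R) ->
    (X - 1%:M) *m (Y - 1%:M) = 0.
  move=> PQ hX hY; apply/matrixP=> i j; rewrite !mxE big1 // => l _; rewrite !mxE.
  have [Pl|Pl] := boolP (P l).
    rewrite hY ?subrr ?mulr0 //; apply: contra (PQ l) => /andP[-> _].
    by rewrite Pl.
  by rewrite hX ?subrr ?mul0r // (negPf Pl) andbF.
set X := swap_mx a b C; set Y := swap_mx c d D.
pose P := pred2 a b; pose Q := pred2 c d.
have PQ l : ~~ (P l && Q l).
  apply/negP=> /andP[/pred2P[]-> /pred2P[] /eqP]; exact/negP.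
have hX i j : ~~ (P i && P j) -> X i j = (i == j)%:R.
  by rewrite negb_and !negb_or; exact: swap_out.
have hY i j : ~~ (Q i && Q j) -> Y i j = (i == j)%:R.
  by rewrite negb_and !negb_or; exact: swap_out.
have := zero _ _ _ _ PQ hX hY; rewrite mulmxBl mulmxBr !mul1mx mulmx1 => /eqP.
rewrite subr_eq0 => /eqP/(canRL (subrK _)) ->.
have QP l : ~~ (Q l && P l) by rewrite andbC.
have := zero _ _ _ _ QP hY hX; rewrite mulmxBl mulmxBr !mul1mx mulmx1 => /eqP.
by rewrite subr_eq0 => /eqP/(canRL (subrK _)) ->; rewrite addrAC [RHS]addrAC (addrC Y).
Qed.
End SwapMatrices.

Lemma full_tr_swap (R : comPzRingType) (k n : nat) (a b : 'I_k) (C : 'M[R]_n) :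
  full_tr (swap_mx a b C) = swap_mx a b C^T.
Proof.
apply/matrixP=> i j; rewrite !mxE raddfD /= andbC.
congr (_ + _); last by case: ifP => //; rewrite trmx0.
rewrite -(inj_eq (@perm_inj _ (tperm a b))) tpermK eq_sym.
by case: (_ == _); rewrite ?trmx0 // -[true%:R]/(1%:M : 'M[R]_n) trmx1.
Qed.

(** * Block Kronecker structure up to block permutations *)

Section KroneckerForm.
Variables (F : fieldType) (n : nat).
Local Notation R := {poly F}.
Local Notation Mn := 'M[R]_n.

(* A permutation-invariant version of the block Kronecker structure: rs and cs
   select the block rows and columns of the body, and w and v carry the powers
   of lambda attached to them. *)
Definition kron_form (k : nat) (T : 'M[Mn]_k) (rs cs : pred 'I_k)
    (w v : 'I_k -> R) (Q : Mn) : Prop :=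
  [/\ forall i, ~~ rs i -> \sum_j v j *: T i j = 0,
      forall j, ~~ cs j -> \sum_i w i *: T i j = 0,
      forall i j, ~~ rs i -> ~~ cs j -> T i j = 0 &
      \sum_i \sum_j w i *: (v j *: T i j) = Q].

Variable k : nat.
Implicit Types (T : 'M[Mn]_k) (rs cs : pred 'I_k) (w v : 'I_k -> R) (Q : Mn).

Lemma kron_form_tr T rs cs w v Q :
  kron_form T rs cs w v Q -> kron_form (full_tr T) cs rs v w Q^T.
Proof.
case=> h1 h2 h3 h4; split=> [i ci|j rj|i j ci rj|].
- transitivity (\sum_j w j *: T j i)^T; last by rewrite h2 // trmx0.
  rewrite raddf_sum; apply: eq_bigr => j _.
  by rewrite mxE -linearZ.
- transitivity (\sum_i v i *: T j i)^T; last by rewrite h1 // trmx0.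
  rewrite raddf_sum; apply: eq_bigr => i _.
  by rewrite mxE -linearZ.
- by rewrite mxE h3 ?trmx0.
- rewrite -h4 exchange_big raddf_sum; apply: eq_bigr => i _.
  rewrite raddf_sum; apply: eq_bigr => j _.
  by rewrite mxE /= !scalerA -linearZ /= mulrC.
Qed.

Lemma kron_formD T T' rs cs w v Q Q' : kron_form T rs cs w v Q ->
  kron_form T' rs cs w v Q' -> kron_form (T + T') rs cs w v (Q + Q').
Proof.
case=> h1 h2 h3 h4 [h1' h2' h3' h4']; split=> [i ri|j cj|i j ri cj|].
- under eq_bigr do rewrite mxE scalerDr.
  by rewrite big_split /= h1 // h1' // addr0.
- under eq_bigr do rewrite mxE scalerDr.
  by rewrite big_split /= h2 // h2' // addr0.
- by rewrite mxE h3 ?h3' ?addr0.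
- rewrite -h4 -h4' -big_split; apply: eq_bigr => i _; rewrite -big_split.
  by apply: eq_bigr => j _; rewrite mxE !scalerDr.
Qed.

Lemma kron_formN T rs cs w v Q :
  kron_form T rs cs w v Q -> kron_form (- T) rs cs w v (- Q).
Proof.
case=> h1 h2 h3 h4; split=> [i ri|j cj|i j ri cj|].
- by under eq_bigr do rewrite mxE scalerN; rewrite sumrN h1 ?oppr0.
- by under eq_bigr do rewrite mxE scalerN; rewrite sumrN h2 ?oppr0.
- by rewrite mxE h3 ?oppr0.
- rewrite -h4 -sumrN; apply: eq_bigr => i _; rewrite -sumrN.
  by apply: eq_bigr => j _; rewrite mxE !scalerN.
Qed.

Lemma eq_kron_form T rs rs' cs cs' w w' v v' Q :
  rs =1 rs' -> cs =1 cs' -> w =1 w' -> v =1 v' ->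
  kron_form T rs cs w v Q -> kron_form T rs' cs' w' v' Q.
Proof.
move=> er ec ew ev [h1 h2 h3 h4]; split=> [i|j|i j|]; rewrite -?er -?ec.
- by move/h1; apply: etrans; apply: eq_bigr => j _; rewrite ev.
- by move/h2; apply: etrans; apply: eq_bigr => i _; rewrite ew.
- exact: h3.
- by rewrite -h4; apply: eq_bigr => i _; apply: eq_bigr => j _; rewrite ew ev.
Qed.

Lemma kron_form_col_perm (s : 'S_k) T rs cs w v Q : kron_form T rs cs w v Q ->
  kron_form (col_perm s T) rs (cs \o s) w (v \o s) Q.
Proof.
case=> h1 h2 h3 h4; split=> [i ri|j cj|i j ri cj|].
- apply: etrans (h1 i ri); rewrite [RHS](reindex_inj (@perm_inj _ s)) /=.
  by apply: eq_bigr => j _; rewrite mxE.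
- by apply: etrans (h2 _ cj); apply: eq_bigr => i _; rewrite mxE.
- by rewrite mxE h3.
- rewrite -h4; apply: eq_bigr => i _; rewrite [RHS](reindex_inj (@perm_inj _ s)).
  by apply: eq_bigr => j _; rewrite mxE.
Qed.

(** The product is a column permutation of [T] plus a matrix whose only nonzero column is a right
    multiple of column [a] of [T]. As [a] is not selected, [w] annihilates that column and it
    vanishes on the unselected rows, so the second matrix has the form with value 0. *)
Lemma kron_form_mul_swap T rs cs w v Q (a b : 'I_k) (C : Mn) :
  ~~ cs a -> kron_form T rs cs w v Q ->
  kron_form (T *m swap_mx a b C) rs (cs \o tperm a b) w (v \o tperm a b) Q.
Proof.
move=> ca [h1 h2 h3 h4].
have -> : T *m swap_mx a b C = col_perm (tperm a b) T +
    \matrix_(i, j) (if j == a then T i a * C else 0).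
  by apply/matrixP=> i j; rewrite mul_swap !mxE.
rewrite -[Q]addr0; apply: kron_formD; first exact: kron_form_col_perm.
split=> [i ri|j cj|i j ri cj|].
- rewrite big1 // => j _; rewrite mxE; case: eqP => _; last exact: scaler0.
  by rewrite h3 // mul0r scaler0.
- under eq_bigr do rewrite mxE; case: (j == a); last first.
    by rewrite big1 // => i _; rewrite scaler0.
  transitivity ((\sum_i w i *: T i a) * C); last by rewrite h2 // mul0r.
  rewrite mulr_suml; apply: eq_bigr => i _; exact: scalemxAl.
- by rewrite mxE h3 // mul0r if_same.
- rewrite exchange_big big1 // => j _; under eq_bigr do rewrite mxE.
  case: (j == a); last by rewrite big1 // => i _; rewrite !scaler0.
  transitivity ((v (tperm a b j)) *: ((\sum_i w i *: T i a) * C)).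
    rewrite mulr_suml scaler_sumr; apply: eq_bigr => i _.
    rewrite scalerA mulrC -scalerA; congr (_ *: _); exact: scalemxAl.
  by rewrite h2 // mul0r scaler0.
Qed.

End KroneckerForm.

(** * The two Fiedler factors *)

Section FiedlerFactor.
Variables (F : fieldType) (n k : nat) (o : nat -> 'I_k).
Local Notation R := {poly F}.
Local Notation Mn := 'M[R]_n.
Implicit Types (C : nat -> Mn) (con : nat -> bool) (rs cs : pred 'I_k).

(* The product of the elementary matrices of indices 0, ..., h, in an order
   that is compatible with con: j precedes j.+1 if and only if con j.  The
   map o sends an index to the block position of its coefficient. *)
Fixpoint fiedler_mx (C : nat -> Mn) (con : nat -> bool) (h : nat) : 'M[Mn]_k :=
  if h is h'.+1 then
    let S := swap_mx (o h) (o h') (C h) in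
    if con h' then fiedler_mx C con h' *m S else S *m fiedler_mx C con h'
  else swap_mx (o 0) (o 0) (C 0%N).

Lemma fiedler_mx_tr C con h : full_tr (fiedler_mx C con h) =
  fiedler_mx (fun j => (C j)^T) (fun j => ~~ con j) h.
Proof.
elim: h => [|h IH] /=; first by rewrite full_tr_swap.
by case: ifP => _ /=; rewrite full_tr_mul full_tr_swap IH.
Qed.

Lemma eq_fiedler_mx C con con' h : (forall j, (j < h)%N -> con j = con' j) ->
  fiedler_mx C con h = fiedler_mx C con' h.
Proof.
elim: h => //= h IH e; rewrite e // IH // => j jh; apply: e; exact: ltnW.
Qed.

Definition index_range (h : nat) : seq 'I_k := map o (iota 0 h).

Lemma index_rangeS h i :
  (i \in index_range h.+1) = (i \in index_range h) || (i == o h).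
Proof.
by rewrite /index_range -(addn1 h) iotaD map_cat mem_cat /= inE add0n.
Qed.

Lemma mem_index_range h j : (j < h)%N -> o j \in index_range h.
Proof. by move=> jh; apply: map_f; rewrite mem_iota. Qed.

Lemma fiedler_mx_out C con h i j :
  (i \notin index_range h.+1) || (j \notin index_range h.+1) ->
  fiedler_mx C con h i j = (i == j)%:R.
Proof.
have row_id (X Y : 'M[Mn]_k) l m : (forall l', X l l' = (l == l')%:R) ->
    (X *m Y) l m = Y l m.
  move=> hX; rewrite mxE (bigD1 l) //= hX eqxx mul1r big1 ?addr0 // => l' /negPf ll.
  by rewrite hX eq_sym ll mul0r.
have col_id (X Y : 'M[Mn]_k) l m : (forall l', Y l' m = (l' == m)%:R) ->
    (X *m Y) l m = X l m.
  move=> hY; rewrite mxE (bigD1 m) //= hY eqxx mulr1 big1 ?addr0 // => l' /negPf ll.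
  by rewrite hY ll mulr0.
elim: h i j => [|h IH] i j.
  by rewrite !index_rangeS /= => ?; apply: swap_out; rewrite !andbb.
have out l : l \notin index_range h.+2 ->
    [/\ l \notin index_range h.+1, l != o h.+1 & l != o h].
  rewrite index_rangeS negb_or => /andP[lh l1]; split=> //.
  by apply: contraNneq lh => ->; exact: mem_index_range.
case/orP=> /out[lh l1 l2]; rewrite [fiedler_mx _ _ _]/=; case: ifP => _.
- rewrite row_id => [|l]; last by rewrite IH ?lh.
  by rewrite swap_out ?l1 ?l2.
- rewrite row_id => [|l]; last by rewrite swap_out ?l1 ?l2.
  by rewrite IH ?lh.
- rewrite col_id => [|l]; last by rewrite swap_out ?l1 ?l2 ?orbT.
  by rewrite IH ?lh ?orbT.
- rewrite col_id => [|l]; last by rewrite IH ?lh ?orbT.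
  by rewrite swap_out ?l1 ?l2 ?orbT.
Qed.

Variables al be : R.

(** The diagonal matrix that isolates a factor from the other one: [be] compensates the identity
    outside the positions of the factor, and 0 stands at the shared position [o h]. Both factors
    yield the same matrix, by [factor_diag_qz]. *)
Definition factor_diag (h : nat) (i : 'I_k) : R :=
  if i \in index_range h then al else if i == o h then 0 else be.

(* The part of the pencil contributed by one of the two Fiedler factors; al and
   be are lambda and 1, or 1 and lambda. *)
Definition factor_pencil (C : nat -> Mn) (con : nat -> bool) (h : nat) : 'M[Mn]_k :=
  \matrix_(i, j) ((if i == j then factor_diag h i else 0)%:M
                  - be *: fiedler_mx C con h i j).

Lemma factor_pencil_tr C con h : full_tr (factor_pencil C con h) =
  factor_pencil (fun j => (C j)^T) (fun j => ~~ con j) h.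
Proof.
apply/matrixP=> i j; rewrite !mxE linearB linearZ /= tr_scalar_mx -fiedler_mx_tr mxE.
by congr (_%:M - _); rewrite eq_sym; case: eqP => // ->.
Qed.

(** Column [a] of the shorter product is still that of the identity, so multiplying by the new
    factor permutes columns and adds [C h.+1] at [(a, a)]. The other two corrections repair the
    diagonal: its entry [be] at [a] was moved to [(a, b)], and [b] must now carry [al]. *)
Lemma factor_pencil_step C con h : {in gtn h.+2 &, injective o} -> con h ->
  let a := o h.+1 in let b := o h in
  factor_pencil C con h.+1 = col_perm (tperm a b) (factor_pencil C con h) +
    \matrix_(i, j) (if (i == a) && (j == a) then - be *: C h.+1
                    else if (i == a) && (j == b) then - be%:M
                    else if (i == b) && (j == b) then al%:M else 0).
Proof.
move=> oI ch a b; have ab : a == b = false.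
  by apply/eqP => /oI; rewrite !inE => /(_ (ltnSn _) (leqnSn _)); lia.
have ba : b == a = false by rewrite eq_sym.
have ah : a \notin index_range h.+1.
  apply/mapP => -[s]; rewrite mem_iota add0n => /andP[_ sh] /oI.
  by rewrite !inE => /(_ (ltnSn _) (ltnW sh)); lia.
have bh : b \notin index_range h.
  apply/mapP => -[s]; rewrite mem_iota add0n => /andP[_ sh] /oI.
  by rewrite !inE => /(_ (leqnSn _) (leqW (leqW sh))); lia.
have ah' : a \notin index_range h by move: ah; rewrite index_rangeS => /norP[].
apply/matrixP=> i j; rewrite !mxE [fiedler_mx _ _ _.+1]/= ch mul_swap.
rewrite (@fiedler_mx_out C con h i a) ?ah ?orbT // scalerDr opprD -!/a -!/b.
rewrite addrA addrAC [RHS]addrAC; congr (_ + _).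
have hb : be *: (if j == a then (i == a)%:R * C h.+1 else 0) =
          if (i == a) && (j == a) then be *: C h.+1 else 0.
  by case: (j == a); case: (i == a); rewrite ?mul1r ?mul0r ?scaler0.
rewrite hb /factor_diag -/a -/b; case: tpermP => [->|->|/eqP/negPf ja /eqP/negPf jb].
- rewrite !eqxx !ab !andbT !andbF; case: eqP => [->|/eqP/negPf ia].
    by rewrite ab (negPf ah) scaleNr.
  by rewrite subr0 addr0; case: eqP => // ->; rewrite (negPf bh).
- rewrite eqxx ba !andbT !andbF subr0.
  case: (i =P a) => [->|/eqP/negPf ia]; first by rewrite ab (negPf ah') subrr raddf0.
  case: (i =P b) => [->|_]; last by rewrite addr0.
  by rewrite index_rangeS -/b eqxx orbT raddf0 add0r.
- rewrite ja jb !andbF subr0 addr0; case: eqP => // ->.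
  by rewrite index_rangeS -/b jb orbF ja.
Qed.

(** [om j] and [nu j] are the row and column weights of position [o j] while [j] is the last index,
    when its row and column are both selected; the next index leaves it only one of them. The
    recurrence for [om] is what makes [w] annihilate column [o h] of the correction in
    [factor_pencil_step]. The added 1 at [j = 0] is the identity part of [swap_mx a a C]. *)
Lemma kron_form_factor C con h rs cs (w v : 'I_k -> R) (om nu : nat -> R) :
  {in gtn h.+1 &, injective o} ->
  (forall j, (j < h)%N -> if con j
    then be * om j.+1 = al * om j /\ nu j.+1 = nu j
    else om j.+1 = om j /\ be * nu j.+1 = al * nu j) ->
  (forall j, (j < h)%N -> rs (o j) = con j /\ cs (o j) = ~~ con j) ->
  (forall j, (j < h)%N -> w (o j) = (if con j then om j else 0) /\
                          v (o j) = (if con j then 0 else nu j)) ->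
  [/\ rs (o h), cs (o h), w (o h) = om h & v (o h) = nu h] ->
  kron_form (factor_pencil C con h) rs cs w v
    (\sum_(j < h.+1) - (be * (om j * nu j)) *: (C j + (j == 0%N :> nat)%:R)).
Proof.
elim: h C con rs cs w v om nu => [|h IH] C con rs cs w v om nu oI hrel hsel hval.
  case=> r0 c0 w0 v0.
  have E i j : factor_pencil C con 0 i j =
      if (i == o 0%N) && (j == o 0%N) then - be *: (C 0%N + 1) else 0.
    rewrite !mxE /= tperm1 perm1 /factor_diag /=; case: (i =P j) => [->|ij].
      rewrite andbb; case: ifP => _; last by rewrite addr0 -scalemx1 subrr.
      by rewrite raddf0 add0r addrC scaleNr.
    case: (i =P o 0%N) => [i0|_]; last by rewrite /= raddf0 addr0 scaler0 subr0.
    case: (j =P o 0%N) => [j0|_]; first by case: ij; rewrite i0.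
    by rewrite /= raddf0 addr0 scaler0 subr0.
  rewrite big_ord1; split=> [i ri|j cj|i j ri cj|].
  - rewrite big1 // => j _; rewrite E; case: (i =P _) => [i0|_];
    last by rewrite scaler0.
    by rewrite i0 r0 in ri.
  - rewrite big1 // => i _; rewrite E andbC; case: (j =P _) => [j0|_];
    last by rewrite scaler0.
    by rewrite j0 c0 in cj.
  - by rewrite E; case: (i =P _) => [i0|//]; rewrite i0 r0 in ri.
  rewrite (bigD1 (o 0%N)) //= [X in _ + X]big1 ?addr0 => [|i /negPf i0]; last first.
    by rewrite big1 // => j _; rewrite E i0 !scaler0.
  rewrite (bigD1 (o 0%N)) //= big1 ?addr0 => [|j /negPf j0]; last first.
    by rewrite E j0 andbF !scaler0.
  by rewrite E eqxx w0 v0 !scalerA; congr (_ *: _); rewrite mulrN mulrC.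
(* Transposition exchanges rows with columns and negates [con], so it is enough to append the new
   factor on the right. *)
wlog ch : C con rs cs w v om nu hrel hsel hval / con h.
  move=> WL; have [|/negPf nch] := boolP (con h); first exact: WL.
  case=> r0 c0 w0 v0.
  have {WL}/kron_form_tr : kron_form (factor_pencil (fun j => (C j)^T)
      (fun j => ~~ con j) h.+1) cs rs v w
      (\sum_(j < h.+2) - (be * (nu j * om j)) *: ((C j)^T + (j == 0%N :> nat)%:R)).
    apply: WL => [j jh|j jh|j jh||//]; rewrite ?nch //.
    - by move: (hrel j jh); case: (con j) => -[].
    - by have [-> ->] := hsel j jh; rewrite negbK.
    - by have [-> ->] := hval j jh; case: (con j).
  rewrite -factor_pencil_tr full_trK raddf_sum /=.
  congr kron_form; apply: eq_bigr => j _.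
  rewrite linearZ linearD /= trmxK [nu _ * _]mulrC; congr (_ *: (_ + _)).
  by case: eqP => _; rewrite ?trmx0 // -[true%:R]/(1%:M : Mn) trmx1.
case=> ra ca wa va; rewrite factor_pencil_step //.
set a := o h.+1 in ra ca wa va *; set b := o h; set s := tperm a b.
have neq j : (j <= h)%N -> (o j == a) = false.
  by move=> jh; apply/eqP => /oI; rewrite !inE => /(_ (leqW jh) (ltnSn _)); lia.
have neqb j : (j < h)%N -> (o j == b) = false.
  move=> jh; apply/eqP => /oI; rewrite !inE => /(_ (leqW (leqW jh)) (leqnSn _)).
  by lia.
have so j : (j < h)%N -> s (o j) = o j.
  by move=> jh; rewrite tpermD // eq_sym ?neq ?neqb // ltnW.
have [om1 nu1] : be * om h.+1 = al * om h /\ nu h.+1 = nu h.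
  by have := hrel h (ltnSn _); rewrite ch.
have [rb cb] := hsel h (ltnSn _); have [wb vb] := hval h (ltnSn _).
rewrite ch -/b in rb cb wb vb.
have oI' : {in gtn h.+1 &, injective o}.
  by move=> i j; rewrite !inE => ih jh; apply: oI; rewrite inE; exact: leqW.
(* Through [s], position [b] receives the selected column and the weight of [a], as the shorter
   product requires; the induction hypothesis asks nothing about position [a]. *)
have IHs : kron_form (factor_pencil C con h) rs (cs \o s) w (v \o s)
    (\sum_(j < h.+1) - (be * (om j * nu j)) *: (C j + (j == 0%N :> nat)%:R)).
  apply: IH => // [j jh|j jh|j jh|].
  - by apply: hrel; exact: ltnW.
  - by rewrite /= so //; apply: hsel; exact: ltnW.
  - by rewrite /= so //; apply: hval; exact: ltnW.
  - by rewrite /= -/b tpermR ca va nu1.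
rewrite big_ord_recr /= addr0; apply: kron_formD.
  have := kron_form_col_perm s IHs; apply: eq_kron_form => // i /=; by rewrite tpermK.
have ab : (a == b) = false by rewrite eq_sym neq.
have Ma i : (\sum_j v j *: (if (i == a) && (j == a) then - be *: C h.+1
    else if (i == a) && (j == b) then - be%:M
    else if (i == b) && (j == b) then al%:M else 0)) =
    if i == a then nu h.+1 *: (- be *: C h.+1) else 0.
  rewrite (bigD1 a) //= big1 ?addr0 => [|j /negPf ja].
    by rewrite eqxx andbT va ab !andbF; case: (i == a); rewrite ?scaler0.
  rewrite ja !andbF; case: (j =P b) => [->|_]; last by rewrite !andbF scaler0.
  by rewrite vb scale0r.
split=> [i ri|j cj|i j ri cj|].
- under eq_bigr do rewrite mxE; rewrite Ma; case: eqP => // ia.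
  by rewrite ia ra in ri.
- under eq_bigr do rewrite mxE; have ja : (j == a) = false.
    by apply/negbTE; apply: contraNneq cj => ->.
  under eq_bigr do rewrite ja andbF.
  have [jb|jb] := eqVneq j b; last by rewrite big1 // => i _; rewrite !andbF scaler0.
  rewrite (bigD1 a) //= (bigD1 b) ?big1 ?addr0 /=.
  + rewrite !eqxx neq // andbT wa wb scalerN !scale_scalar_mx.
    rewrite [om h.+1 * _]mulrC om1 [al * _]mulrC.
    by rewrite addr0 addNr.
  + by move=> i /andP[/negPf-> /negPf->]; rewrite scaler0.
  + by rewrite neq.
- rewrite mxE; case: (i =P a) => [ia|_]; first by rewrite ia ra in ri.
  by case: (i =P b) => [ib|//]; rewrite ib rb in ri.
- transitivity (\sum_i w i *: (if i == a then nu h.+1 *: (- be *: C h.+1) else 0)).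
    apply: eq_bigr => i _; rewrite -Ma scaler_sumr; apply: eq_bigr => j _.
    by rewrite mxE.
  rewrite (bigD1 a) //= eqxx big1 ?addr0 => [|i /negPf->]; last by rewrite scaler0.
  by rewrite wa !scalerA mulrN mulrC.
Qed.
End FiedlerFactor.

(** The factor of the largest index commutes with all others except that of its predecessor, hence
    moves to the right end or to the left end according to which of the two comes first. For [j = 0]
    the two positions coincide, since [0.-1] is 0. *)
Lemma prod_fiedler (F : fieldType) (n k : nat) (o : nat -> 'I_k)
    (C : nat -> 'M[{poly F}]_n) (h : nat) (t : seq nat) :
  {in gtn h.+1 &, injective o} -> perm_eq t (iota 0 h.+1) ->
  \prod_(j <- t) (swap_mx (o j) (o j.-1) (C j)) =
  fiedler_mx o C (fun j => before t j j.+1) h.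
Proof.
elim: h t => [|h IH] t oI pt.
  by move/perm_small_eq: pt => -> //; rewrite big_seq1.
case/perm_iota_split: pt => t1 [t2 [-> pt]].
have oI' : {in gtn h.+1 &, injective o}.
  by move=> i j; rewrite !inE => ih jh; apply: oI; rewrite inE; exact: leqW.
have comm u : (forall j, j \in u -> (j < h)%N) ->
    swap_mx (o h.+1) (o h) (C h.+1) * (\prod_(j <- u) swap_mx (o j) (o j.-1) (C j)) =
    (\prod_(j <- u) swap_mx (o j) (o j.-1) (C j)) * swap_mx (o h.+1) (o h) (C h.+1).
  elim: u => [|x u IHu] hu; first by rewrite big_nil mulr1 mul1r.
  rewrite big_cons -mulrA -IHu => [|j ju]; last by apply: hu; rewrite inE ju orbT.
  have xh : (x < h)%N by apply: hu; rewrite inE eqxx.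
  rewrite !mulrA; congr (_ * _); apply: swap_mxC; apply/eqP=> /oI;
    rewrite !inE => e; (suff: False by []); move: e; lia.
have Ut := perm_uniq pt; rewrite iota_uniq cat_uniq in Ut;
  case/and3P: Ut => Ut1 /hasPn Ut2 Ut3.
have t_le c : c \in t1 ++ t2 -> (c <= h)%N by rewrite (perm_mem pt) mem_iota; lia.
rewrite [RHS]/=.
have -> : fiedler_mx o C (fun j => before (t1 ++ h.+1 :: t2) j j.+1) h =
    fiedler_mx o C (fun j => before (t1 ++ t2) j j.+1) h.
  by apply: eq_fiedler_mx => j jh; rewrite before_remove //; lia.
rewrite -IH // !big_cat big_cons /=.
have h1t : h.+1 \notin t1.
  by apply/negP=> h1; have := t_le h.+1; rewrite mem_cat h1 => /(_ isT); lia.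
rewrite /before !index_cat /= eqxx (negPf h1t).
have [ht1|ht1] := boolP (h \in t1).
  have -> : (index h t1 < size t1 + 0)%N by rewrite addn0 index_mem.
  rewrite comm ?mulrA // => j jt; have := t_le j; rewrite mem_cat jt orbT => /(_ isT).
  suff : j != h by lia.
  by apply/negP => /eqP e; have /negP := Ut2 j jt; apply; rewrite e.
rewrite (_ : (_ < _)%N = false); last by lia.
rewrite [RHS]mulrA (comm t1) ?mulrA // => j jt.
have := t_le j; rewrite mem_cat jt => /(_ isT).
by suff : j != h; [lia|apply: contraNneq ht1 => <-].
Qed.

(** * Repetition factors *)

Section RepetitionFactors.
Variables (F : fieldType) (n k : nat).
Local Notation Mn := 'M[{poly F}]_n.
Implicit Types (L : 'M[Mn]_k) (rl cl : 'I_k -> option nat) (Q : Mn).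

(** Recording exponents, with [None] for an unselected position, turns the requirement that each
    power occurs once into a statement about [codom] up to permutation. *)
Definition monomial (e : option nat) : {poly F} := if e is Some i then 'X^i else 0.

Definition labelled_form L rl cl Q : Prop :=
  kron_form L (isSome \o rl) (isSome \o cl) (monomial \o rl) (monomial \o cl) Q.

Lemma labelled_form_tr L rl cl Q :
  labelled_form L rl cl Q -> labelled_form (full_tr L) cl rl Q^T.
Proof. exact: kron_form_tr. Qed.

Lemma perm_codom (T : eqType) (f : 'I_k -> T) (s : 'S_k) :
  perm_eq (codom (f \o s)) (codom f).
Proof.
rewrite !codomE (map_comp f s); apply: perm_map; apply: uniq_perm.
- by rewrite map_inj_uniq ?enum_uniq //; exact: perm_inj.
- exact: enum_uniq.
- by move=> i; rewrite mem_enum -[i](permKV s) map_f ?mem_enum.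
Qed.

Variable o : nat -> 'I_k.

Definition word_mx (r : seq (nat * Mn)) : 'M[Mn]_k :=
  \prod_(x <- r) swap_mx (o x.1) (o x.1.-1) x.2.

Lemma full_tr_word_mx r :
  full_tr (word_mx r) = word_mx (rev [seq (x.1, x.2^T) | x <- r]).
Proof.
rewrite /word_mx; elim: r => [|x r IH] /=; first by rewrite !big_nil full_tr1.
rewrite big_cons rev_cons -cats1 big_cat big_seq1 -IH /=.
by rewrite full_tr_mul full_tr_swap.
Qed.

(* Before a repeated index i is appended, its last occurrence must be followed
   by i + 1 (this is the SIP); the invariant says that column o i is then not
   selected, so that it may be added to another column. *)
Lemma labelled_form_mul_word (h : nat) (acc : seq nat) (r : seq (nat * Mn)) L rl cl Q :
  {in gtn h.+1 &, injective o} ->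
  (forall j, (j < h)%N -> before acc j.+1 j -> cl (o j) = None) ->
  (forall r1 i r2, unzip1 r = r1 ++ i :: r2 ->
     (i < h)%N /\ before (rev r1 ++ acc) i.+1 i) ->
  labelled_form L rl cl Q ->
  exists cl', [/\ labelled_form (L *m word_mx r) rl cl' Q,
    perm_eq (codom cl') (codom cl) &
    forall i, i \notin index_range o h -> cl' i = cl i].
Proof.
move=> oI; elim: r acc L cl => [|[i C] r IH] acc L cl inv sip Lf.
  by exists cl; rewrite /word_mx big_nil mulmx1.
have [ih bi] := sip [::] i (unzip1 r) erefl.
have ci : cl (o i) = None by exact: inv.
set s := tperm (o i) (o i.-1).
have Lf' : labelled_form (L *m swap_mx (o i) (o i.-1) C) rl (cl \o s) Q.
  by apply: kron_form_mul_swap Lf; rewrite /= ci.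
have oE j j' : (j <= h)%N -> (j' <= h)%N -> (o j == o j') = (j == j').
  by move=> jh jh'; apply/eqP/eqP=> [|-> //]; apply: oI; rewrite inE ltnS.
case: (IH (i :: acc) _ (cl \o s) _ _ Lf') => [j jh|r1 j r2 e|cl' [Lc pc oc]].
- have [-> | ji] := eqVneq j i; first by rewrite /before /= eqxx ltn0.
  (* Prepending [i] places it before [i - 1], so column [o i.-1] must now be unselected; it is,
     because the swap has just moved the unselected column [o i] there. *)
  have [ji1 _ | ji1] := eqVneq j.+1 i.
    by rewrite /= (_ : j = i.-1) ?tpermR //; lia.
  rewrite (@before_remove _ j.+1 j i [::] acc) //= tpermD; last 2 first.
  + by rewrite oE //; lia.
  + by rewrite oE //; lia.
  exact: inv.
- by have := sip (i :: r1) j r2; rewrite /= e rev_cons cat_rcons => /(_ erefl).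
exists cl'; split.
- by rewrite /word_mx big_cons -mulmxE mulmxA.
- exact: perm_trans pc (perm_codom _ _).
- move=> j jn; rewrite oc // /= tpermD //; apply: contraNneq jn => <-;
    apply: mem_index_range; lia.
Qed.

Lemma labelled_form_word_mul (h : nat) (acc : seq nat) (l : seq (nat * Mn)) L rl cl Q :
  {in gtn h.+1 &, injective o} ->
  (forall j, (j < h)%N -> before acc j.+1 j -> rl (o j) = None) ->
  (forall l1 i l2, unzip1 l = l1 ++ i :: l2 ->
     (i < h)%N /\ before (l2 ++ acc) i.+1 i) ->
  labelled_form L rl cl Q ->
  exists rl', [/\ labelled_form (word_mx l *m L) rl' cl Q,
    perm_eq (codom rl') (codom rl) &
    forall i, i \notin index_range o h -> rl' i = rl i].
Proof.
move=> oI inv sip /labelled_form_tr Lf.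
case: (labelled_form_mul_word (r := rev [seq (x.1, x.2^T) | x <- l]) oI inv _ Lf).
  move=> r1 i r2; rewrite /unzip1 map_rev -map_comp => /(canRL revK).
  rewrite rev_cat rev_cons cat_rcons => e.
  by have [ih] := sip _ _ _ e.
move=> rl' [Lf' pc oc]; exists rl'; split=> //.
by move/labelled_form_tr: Lf';
  rewrite full_tr_mul full_trK -full_tr_word_mx full_trK trmxK.
Qed.
End RepetitionFactors.

(** * Equivalence of block-matrices *)

Lemma flatten_mxE (R : Type) (a b n : nat) (H : 'M['M[R]_n]_(a, b)) i j :
  flatten_mx H i j =
  H (tagnat.sig1 i) (tagnat.sig1 j) (tagnat.sig2 i) (tagnat.sig2 j).
Proof. by rewrite mxE. Qed.

Lemma flatten_inj (R : Type) (a b n : nat) : injective (@flatten_mx R a b n).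
Proof.
move=> G H e; apply/matrixP=> i j.
have := congr1 (fun T => submxblock T i j) e.
by rewrite /flatten_mx !mxblockK.
Qed.

Lemma flatten_mul (R : pzSemiRingType) (a b c n : nat)
    (G : 'M['M[R]_n]_(a, b)) (H : 'M['M[R]_n]_(b, c)) :
  flatten_mx (G *m H) = flatten_mx G *m flatten_mx H.
Proof. by rewrite /flatten_mx mul_mxblock; apply/eq_mxblockP=> i j; rewrite mxE. Qed.

Lemma flat_index (k n : nat) (i : 'I_(\sum_(l < k) n)) :
  i = (tagnat.sig1 i * n + tagnat.sig2 i)%N :> nat.
Proof.
rewrite [LHS]tagnat.rect; congr (_ + _)%N.
by rewrite -(big_ord_widen _ (fun=> n)) ?sum_nat_const ?card_ord // ltnW.
Qed.

Lemma flat_index_eq (k n : nat) (i j : 'I_(\sum_(l < k) n)) :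
  (i == j) = (tagnat.sig1 i == tagnat.sig1 j) &&
             (tagnat.sig2 i == tagnat.sig2 j :> nat).
Proof.
apply/eqP/andP=> [->|[/eqP e1 /eqP e2]]; first by rewrite !eqxx.
by apply: val_inj; rewrite /= [LHS]flat_index e1 e2 -flat_index.
Qed.

Lemma flatten1 (R : pzSemiRingType) (k n : nat) :
  flatten_mx (1%:M : 'M['M[R]_n]_k) = 1%:M.
Proof.
apply/matrixP=> i j; rewrite flatten_mxE !mxE flat_index_eq.
by case: (tagnat.sig1 i == _); rewrite mxE.
Qed.

Lemma flatten_full_tr (R : Type) (a b n : nat) (H : 'M['M[R]_n]_(a, b)) :
  flatten_mx (full_tr H) = (flatten_mx H)^T.
Proof. by apply/matrixP=> i j; rewrite [RHS]mxE !flatten_mxE !mxE. Qed.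

Section BlockUnits.
Variables (R : comUnitRingType) (n : nat).
Local Notation Mn := 'M[R]_n.

Definition block_unit (k : nat) (U : 'M[Mn]_k) : Prop :=
  exists V, U *m V = 1%:M /\ V *m U = 1%:M.

Lemma block_unit_flatten (k : nat) (U : 'M[Mn]_k) :
  block_unit U <-> flatten_mx U \in unitmx.
Proof.
split=> [[V [UV _]]|Uu].
  by have/(congr1 (@flatten_mx _ _ _ _)) := UV;
    rewrite flatten_mul flatten1 => /mulmx1_unit[].
exists (\matrix_(i, j) submxblock (invmx (flatten_mx U)) i j).
have eV : flatten_mx (\matrix_(i, j) submxblock (invmx (flatten_mx U)) i j) =
    invmx (flatten_mx U).
  rewrite -[RHS]submxblockK; apply/eq_mxblockP=> i j; by rewrite mxE.
by split; apply: flatten_inj; rewrite flatten_mul flatten1 eV ?mulmxV ?mulVmx.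
Qed.

(** A one-sided inverse is two-sided here because flattening leads to square matrices over the
    commutative ring [R]. *)
Lemma block_unit_mul1 (k : nat) (U V : 'M[Mn]_k) :
  U *m V = 1%:M -> block_unit U /\ block_unit V.
Proof.
move/(congr1 (@flatten_mx _ _ _ _)); rewrite flatten_mul flatten1.
by move/mulmx1_unit=> [] /block_unit_flatten ? /block_unit_flatten.
Qed.

Lemma block_unitM (k : nat) (U V : 'M[Mn]_k) :
  block_unit U -> block_unit V -> block_unit (U *m V).
Proof.
by rewrite !block_unit_flatten flatten_mul unitmx_mul => -> ->.
Qed.

Lemma block_unit_tr (k : nat) (U : 'M[Mn]_k) : block_unit U -> block_unit (full_tr U).
Proof. by rewrite !block_unit_flatten flatten_full_tr unitmx_tr. Qed.

Lemma block_unit_perm (k : nat) (s : 'S_k) : block_unit (perm_mx s : 'M[Mn]_k).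
Proof.
by exists (perm_mx s^-1%g); rewrite -!perm_mxM mulgV mulVg perm_mx1.
Qed.

Lemma block_unit_diag (a b : nat) (U : 'M[Mn]_a) (V : 'M[Mn]_b) :
  block_unit U -> block_unit V -> block_unit (block_mx U 0 0 V).
Proof.
move=> [U' [UU' _]] [V' [VV' _]].
apply: (proj1 (@block_unit_mul1 _ _ (block_mx U' 0 0 V') _)).
by rewrite mulmx_block !mulmx0 !mul0mx !addr0 !add0r UU' VV' -scalar_mx_block.
Qed.

Lemma block_unit_upper (a b : nat) (Y : 'M[Mn]_(a, b)) :
  block_unit (block_mx 1%:M Y 0 1%:M).
Proof.
apply: (proj1 (@block_unit_mul1 _ _ (block_mx 1%:M (- Y) 0 1%:M) _)).
rewrite mulmx_block !mulmx0 !mul0mx !addr0 !add0r !mul1mx !mulmx1 addNr.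
by rewrite -scalar_mx_block.
Qed.

Lemma block_unit_lower (a b : nat) (Y : 'M[Mn]_(b, a)) :
  block_unit (block_mx 1%:M 0 Y 1%:M).
Proof.
apply: (proj1 (@block_unit_mul1 _ _ (block_mx 1%:M 0 (- Y) 1%:M) _)).
rewrite mulmx_block !mulmx0 !mul0mx !addr0 !add0r !mul1mx !mulmx1 addrN.
by rewrite -scalar_mx_block.
Qed.

Definition block_equiv (a b : nat) (G H : 'M[Mn]_(a, b)) : Prop :=
  exists U V, [/\ block_unit U, block_unit V & U *m G *m V = H].

Lemma block_equiv_trans (a b : nat) (G H K : 'M[Mn]_(a, b)) :
  block_equiv G H -> block_equiv H K -> block_equiv G K.
Proof.
move=> [U [V [uU uV <-]]] [U' [V' [uU' uV' <-]]].
exists (U' *m U), (V *m V'); split; try exact: block_unitM.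
by rewrite !mulmxA.
Qed.

Lemma block_equiv_perm (a b : nat) (G : 'M[Mn]_(a, b)) (s : 'S_a) (t : 'S_b) :
  block_equiv G (row_perm s (col_perm t G)).
Proof.
exists (perm_mx s), (perm_mx t^-1); split; try exact: block_unit_perm.
by rewrite col_permE row_permE mulmxA.
Qed.

Lemma block_equiv_cast (a b c d : nat) (er : a = c) (ec : b = d) (G H : 'M[Mn]_(a, b)) :
  block_equiv G H -> block_equiv (castmx (er, ec) G) (castmx (er, ec) H).
Proof. by case: _ / er; case: _ / ec; rewrite !castmx_id. Qed.

Definition diag_last (K : nat) (Q : Mn) : 'M[Mn]_K.+1 :=
  \matrix_(i, j) (if i == j then (if i == ord_max then Q else 1) else 0).

Lemma flatten_equiv_diag (K : nat) (L : 'M[Mn]_K.+1) (Q : Mn) :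
  block_equiv L (diag_last K Q) ->
  exists (s : nat) (e : (\sum_(l < K.+1) n)%N = (s + n)%N) U V,
    [/\ U \in unitmx, V \in unitmx &
        castmx (e, e) (U *m flatten_mx L *m V) = block_mx 1%:M 0 0 Q].
Proof.
case=> U [V [/block_unit_flatten uU /block_unit_flatten uV E]].
have e : (\sum_(l < K.+1) n)%N = (K * n + n)%N.
  by rewrite sum_nat_const card_ord mulSn addnC.
exists (K * n)%N, e, (flatten_mx U), (flatten_mx V); split=> //.
rewrite -!flatten_mul E; apply/matrixP=> i j; rewrite castmxE flatten_mxE mxE.
have -> : block_mx 1%:M 0 0 Q i j = match split i, split j with
    | inl i0, inl j0 => (i0 == j0)%:R | inr i0, inr j0 => Q i0 j0
    | _, _ => 0 end.
  by rewrite mxE; case: (split i) => i0; rewrite mxE; case: (split j) => j0;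
    rewrite ?mxE.
set i' := cast_ord _ i; set j' := cast_ord _ j.
have split_index (l : 'I_(K * n + n)) (l' := cast_ord (esym e) l) :
    match split l with
    | inl _ => tagnat.sig1 l' != ord_max
    | inr m => tagnat.sig1 l' = ord_max /\ tagnat.sig2 l' = m :> nat
    end.
  have := flat_index l'; rewrite /=; have := ltn_ord (tagnat.sig2 l').
  have := ltn_ord (tagnat.sig1 l'); case: splitP => m lm.
    move=> s1 s2 lE; apply/eqP=> smax; move: lE; rewrite smax /= lm.
    by have := ltn_ord m; lia.
  move=> s1 s2; rewrite lm => lE.
  have sK : tagnat.sig1 l' = K :> nat.
    by have := ltn_ord m; move: s1 s2 lE; set x := nat_of_ord _;
      set y := nat_of_ord _; nia.
  by split; [apply: val_inj | move: lE; rewrite sK; lia].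
have := split_index i; have := split_index j; rewrite -/i' -/j'.
have := flat_index_eq i' j'; rewrite /i' /j' (inj_eq (@cast_ord_inj _ _ _)) -/i' -/j'.
rewrite -[i in i == j](splitK i) -[j in _ == j](splitK j).
case: (split i) => i0; case: (split j) => j0 /=.
- rewrite (inj_eq (@lshift_inj _ _)) => -> _ /negPf->.
  by case: (_ == _); rewrite ?mxE.
- by rewrite eq_lrshift => _ [-> _] /negPf->; rewrite mxE.
- by rewrite eq_rlshift => _ jm [-> _]; rewrite eq_sym (negPf jm) mxE.
- move=> _ [-> j2] [-> i2]; rewrite !eqxx.
  by congr (Q _ _); exact: val_inj.
Qed.
End BlockUnits.

(** * Block Kronecker linearizations *)

Section BlockKroneckerLinearization.
Variables (F : fieldType) (n : nat).
Local Notation R := {poly F}.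
Local Notation Mn := 'M[R]_n.

(* The wing pencil L_p (x) I_n, up to sign. *)
Definition bidiag (p : nat) : 'M[Mn]_(p, p.+1) :=
  \matrix_(i, j) (if j == i.+1 :> nat then 'X%:M else if j == i :> nat then -1 else 0).

(** The last row completes [bidiag p] to a unimodular square matrix with inverse [bidiag_inv p]. *)
Definition bidiag_ext (p : nat) : 'M[Mn]_p.+1 :=
  \matrix_(i, j) (if i == p :> nat then (j == p :> nat)%:R
    else if j == i.+1 :> nat then 'X%:M else if j == i :> nat then -1 else 0).

(** The last column is [Lambda_col], which [bidiag p] annihilates; the other columns form a right
    inverse of [bidiag p]. *)
Definition bidiag_inv (p : nat) : 'M[Mn]_p.+1 :=
  \matrix_(i, j) (if j == p :> nat then ('X^(p - i))%:M
    else if (i <= j)%N then - ('X^(j - i))%:M else 0).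

Lemma bidiag_mul (p m : nat) (T : 'M[Mn]_(p.+1, m)) i j :
  (bidiag p *m T) i j =
  'X *: T (lift ord0 i) j - T (widen_ord (leqnSn p) i) j.
Proof.
rewrite mxE (bigD1 (lift ord0 i)) //= (bigD1 (widen_ord (leqnSn p) i)) /=; last first.
  by rewrite -val_eqE /= /bump; lia.
rewrite !mxE /= /bump leq0n add1n eqxx ltn_eqF // eqxx mulN1r.
rewrite -[_%:M * _]/(_%:M *m _) mul_scalar_mx big1 ?addr0 // => l /andP[l1 l2].
move: l1 l2; rewrite -!val_eqE /= /bump leq0n add1n mxE => /negPf-> /negPf->.
exact: mul0r.
Qed.

Lemma bidiag_invE (p : nat) i j :
  (bidiag p *m bidiag_inv p) i j = (i == j :> nat)%:R.
Proof.
rewrite bidiag_mul !mxE /= /bump leq0n add1n.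
have ip := ltn_ord i; have jp := ltn_ord j; case: (j =P p :> nat) => [ejp|/eqP ejp].
  rewrite (_ : (i == j :> nat) = false); last by lia.
  by rewrite scale_scalar_mx -exprS (_ : (p - i.+1).+1 = p - i)%N ?subrr //; lia.
case: (ltngtP i j) => ij.
- by rewrite scalerN scale_scalar_mx -exprS opprK (_ : (j - i.+1).+1 = j - i)%N
  ?addNr //; lia.
- by rewrite scaler0 subr0.
- by rewrite ij subnn scaler0 sub0r opprK.
Qed.

Lemma block_unit_bidiag_inv (p : nat) : block_unit (bidiag_inv p).
Proof.
apply: (proj2 (@block_unit_mul1 _ _ _ (bidiag_ext p) _ _)).
apply/matrixP=> i j; have [ip|ip] := eqVneq (i : nat) p.
  rewrite mxE (bigD1 ord_max) //= !mxE ip !eqxx big1 ?addr0.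
    rewrite mul1r -val_eqE /= ip eq_sym; have jp := ltn_ord j.
    case: eqP => [_|/eqP ejp]; first by rewrite subnn.
    by rewrite leqNgt (_ : (j < p)%N) //; lia.
  move=> l; rewrite -val_eqE /= => /negPf lp; by rewrite mxE ip eqxx lp mul0r.
have ip' : (i < p)%N by have := ltn_ord i; lia.
transitivity ((bidiag p *m bidiag_inv p) (Ordinal ip') j).
  by rewrite !mxE; apply: eq_bigr => l _; rewrite !mxE /= (negPf ip).
by rewrite bidiag_invE mxE.
Qed.

(** This is (Lambda_q (x) I) M (Lambda_p^T (x) I), the matrix polynomial that the block Kronecker
    pencil linearizes. *)
Definition kron_body (p q : nat) (M : 'M[Mn]_(q.+1, p.+1)) : Mn :=
  \sum_(i < q.+1) \sum_(j < p.+1) 'X^(q - i) *: ('X^(p - j) *: M i j).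

Lemma kron_equiv_core (p q : nat) (M : 'M[Mn]_(q.+1, p.+1)) (N1 : 'M[Mn]_p)
    (N2 : 'M[Mn]_q) : block_unit N1 -> block_unit N2 ->
  block_equiv (block_mx M (full_tr (N2 *m bidiag q)) (N1 *m bidiag p) 0)
    (block_mx (\matrix_(i, j) (if (i == q :> nat) && (j == p :> nat)
                               then kron_body M else 0))
       (\matrix_(i, j) (i == j :> nat)%:R) (\matrix_(i, j) (i == j :> nat)%:R) 0).
Proof.
move=> uN1 uN2; have [N1' [N1V VN1]] := uN1; have [N2' [N2V VN2]] := uN2.
have uN1' : block_unit N1' by have [] := block_unit_mul1 N1V.
have uN2' : block_unit N2' by have [] := block_unit_mul1 N2V.
set Vp := bidiag_inv p; set Vq := bidiag_inv q.
pose M' := full_tr Vq *m M *m Vp.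
set Jp : 'M[Mn]_(p, p.+1) := \matrix_(i, j) (i == j :> nat)%:R.
set Jq : 'M[Mn]_(q.+1, q) := \matrix_(i, j) (i == j :> nat)%:R.
have JpE : bidiag p *m Vp = Jp by apply/matrixP=> i j; rewrite bidiag_invE mxE.
have JqE : full_tr Vq *m full_tr (bidiag q) = Jq.
  rewrite -full_tr_mul; apply/matrixP=> i j;
    rewrite [LHS]mxE bidiag_invE [RHS]mxE eq_sym.
  by case: eqP => _; rewrite ?trmx0 // -[true%:R]/(1%:M : Mn) trmx1.
have uVp := block_unit_bidiag_inv p; have uVq := block_unit_bidiag_inv q.
apply: (@block_equiv_trans _ _ _ _ _ (block_mx M' Jq Jp 0)).
  exists (block_mx (full_tr Vq) 0 0 N1'), (block_mx Vp 0 0 (full_tr N2')).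
  split; try by apply: block_unit_diag => //; exact: block_unit_tr.
  rewrite !mulmx_block !mulmx0 !mul0mx !addr0 !add0r ?mul0mx.
  congr block_mx.
  - rewrite full_tr_mul mulmxA -!mulmxA -full_tr_mul.
    by rewrite VN2 full_tr1 mulmx1 JqE.
  - by rewrite mulmxA VN1 mul1mx.
(* With the wings reduced to [[I 0]], [Y] clears all columns of the body but the last, and [X]
   clears the last column above its corner. The corner is the product of the last columns of the two
   inverses with [M], which is [kron_body M]. *)
pose Y : 'M[Mn]_(q.+1, p) := \matrix_(i, l) M' i (widen_ord (leqnSn p) l).
pose X : 'M[Mn]_(q, p.+1) := \matrix_(l, j)
  (if j == p :> nat then M' (widen_ord (leqnSn q) l) j else 0).
exists (block_mx 1%:M (- Y) 0 1%:M), (block_mx 1%:M 0 (- X) 1%:M).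
split; [exact: block_unit_upper | exact: block_unit_lower |].
rewrite !mulmx_block !mulmx0 !mul0mx !mul1mx !mulmx1 !addr0 !add0r !mul0mx !addr0
  ?add0r.
congr block_mx; apply/matrixP=> i j.
have YJ : (Y *m Jp) i j = if j == p :> nat then 0 else M' i j.
  rewrite mxE; case: eqP => [jp|/eqP jp].
    by rewrite big1 // => l _; rewrite [Jp _ _]mxE jp ltn_eqF // mulr0.
  have jp' : (j < p)%N by have := ltn_ord j; lia.
  rewrite (bigD1 (Ordinal jp')) //= [Y _ _]mxE [Jp _ _]mxE eqxx mulr1.
  rewrite big1 ?addr0 => [|l].
    by congr (M' _ _); apply: val_inj.
  by rewrite -val_eqE /= => /negPf lj; rewrite [Jp _ _]mxE lj mulr0.
have JX : (Jq *m X) i j = if (i == q :> nat) || (j != p :> nat) then 0 else M' i j.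
  rewrite mxE; case: eqP => [iq|/eqP iq] /=.
    by rewrite big1 // => l _; rewrite [Jq _ _]mxE iq eq_sym ltn_eqF // mul0r.
  have iq' : (i < q)%N by have := ltn_ord i; lia.
  rewrite (bigD1 (Ordinal iq')) //= [Jq _ _]mxE [X _ _]mxE eqxx mul1r.
  rewrite big1 ?addr0 => [|l].
    by rewrite -if_neg; case: (j != p :> nat) => //; congr (M' _ _); apply: val_inj.
  by rewrite -val_eqE eq_sym /= => /negPf lj; rewrite [Jq _ _]mxE lj mul0r.
rewrite !mulmxN !mulNmx [LHS]mxE [X in X + _]mxE [X in _ + X + _]mxE [X in _ + X]mxE.
rewrite YJ JX [RHS]mxE; case: (i =P q :> nat) => iq; case: (j =P p :> nat) => jp /=;
  last 3 first.
- by rewrite subr0 subrr.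
- by rewrite subr0 subrr.
- by rewrite subr0 subrr.
rewrite !subr0 /M' -mulmxA mxE; apply: eq_bigr => l _.
rewrite [X in _ * X]mxE mulr_sumr; apply: eq_bigr => m _; rewrite !mxE iq jp !eqxx.
rewrite tr_scalar_mx -[_ * _%:M]/(_ *m _%:M) mul_mx_scalar.
exact: mul_scalar_mx.
Qed.

Lemma kron_linearization (p q K : nat) (er : (q.+1 + p = K.+1)%N)
    (ec : (p.+1 + q = K.+1)%N) (M : 'M[Mn]_(q.+1, p.+1)) (N1 : 'M[Mn]_p)
    (N2 : 'M[Mn]_q) : block_unit N1 -> block_unit N2 ->
  block_equiv
    (castmx (er, ec) (block_mx M (full_tr (N2 *m bidiag q)) (N1 *m bidiag p) 0))
    (diag_last K (kron_body M)).
Proof.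
move=> uN1 uN2; have := block_equiv_cast er ec (kron_equiv_core M uN1 uN2).
set D := castmx _ (block_mx (\matrix_(i, j) _) _ _ _) => CD.
apply: block_equiv_trans CD _ => {N1 N2 uN1 uN2}.
(* [f j] is the row of the only nonzero block in column [j] of [D]: the wing identities occupy the
   columns other than [p], and the corner of the body is at [(q, p)]. *)
pose f (j : 'I_K.+1) : 'I_K.+1 :=
  inord (if (j < p)%N then (j + q.+1)%N else if j == p :> nat then q else (j - p.+1)%N).
have fE j : f j = (if (j < p)%N then j + q.+1
    else if j == p :> nat then q else j - p.+1)%N :> nat.
  by rewrite /f inordK //; have := ltn_ord j; case: (ltngtP j p); lia.
have fI : injective f.
  move=> i j /(congr1 val); rewrite /= !fE => e; apply: val_inj => /=.
  have := ltn_ord i; have := ltn_ord j; move: e.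
  case: (ltngtP i p); case: (ltngtP j p); lia.
have DE i j : D i j =
    if i == f j then (if j == p :> nat then kron_body M else 1) else 0.
  rewrite /D castmxE; set i' := cast_ord _ i; set j' := cast_ord _ j.
  have iE : i = i' :> nat by []; have jE : j = j' :> nat by [].
  rewrite -val_eqE /= fE iE jE mxE; case: splitP => i0 ii0; rewrite mxE.
    case: splitP => j0 jj0; rewrite !mxE jj0 ii0.
      have := ltn_ord i0; have := ltn_ord j0; case: (j0 =P p :> nat) => jp l1 l2.
        by rewrite andbT jp ltnn.
      rewrite andbF (_ : (j0 < p)%N = true); last by lia.
      by case: eqP => //; lia.
    have := ltn_ord i0; have := ltn_ord j0; move=> l1 l2.
    have -> : (p.+1 + j0 < p)%N = false by lia.
    have -> : (p.+1 + j0 == p)%N = false by lia.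
    rewrite (_ : p.+1 + j0 - p.+1 = j0)%N; last by lia.
    by case: eqP.
  case: splitP => j0 jj0; rewrite !mxE jj0 ii0.
    have := ltn_ord i0; have := ltn_ord j0; case: (j0 =P p :> nat) => jp l1 l2.
      rewrite jp ltnn (_ : (i0 == p :> nat) = false); last by lia.
      by rewrite (_ : (q.+1 + i0 == q)%N = false) //; lia.
    have -> : (j0 < p)%N by lia.
    by rewrite [in RHS]addnC eqn_add2r eq_sym (eq_sym (j0 : nat)); case: eqP.
  have := ltn_ord i0; have := ltn_ord j0; move=> l1 l2; rewrite ifF //.
  by rewrite !ifF; lia.
(* The permutation [s] puts the nonzero blocks on the diagonal, and [u] then exchanges the position
   [p] of the body with the last one. *)
pose s := perm fI; have lt_pK : (p < K.+1)%N by lia.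
pose u := tperm ord_max (Ordinal lt_pK).
have -> : diag_last K (kron_body M) = row_perm (u * s)%g (col_perm u D).
  apply/matrixP=> i j; rewrite !mxE DE permM permE (inj_eq fI) (inj_eq (@perm_inj _ u)).
  case: eqP => // <-; congr (if _ then _ else _).
  by rewrite -(inj_eq (@perm_inj _ u)) tpermL -val_eqE.
exact: block_equiv_perm.
Qed.
End BlockKroneckerLinearization.

(** * Wing pencils and their reversals *)

Section Pencils.
Variables (F : fieldType) (n : nat).
Local Notation R := {poly F}.
Local Notation Mn := 'M[R]_n.

Lemma block_pencilP (a b : nat) (H : 'M[Mn]_(a, b)) :
  is_block_pencil H <-> forall i j, has_grade 1 (H i j).
Proof.
split=> hH i j; last by rewrite flatten_mxE; exact: hH.
have -> : H i j = submxblock (flatten_mx H) i j by rewrite mxblockK.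
by move=> x y; rewrite mxE.
Qed.

Lemma pencil_decomp (A : Mn) : has_grade 1 A ->
  A = 'X *: map_mx polyC (coef_mx 1 A) + map_mx polyC (coef_mx 0 A).
Proof.
move=> hA; apply/matrixP=> i j; rewrite !mxE; apply/polyP=> s.
rewrite coefD coefXM !coefC; case: s => [|[|s]] /=; rewrite ?add0r ?addr0 //.
by rewrite nth_default // (leq_trans (hA i j)).
Qed.

Lemma mul_bidiag (a p : nat) (T : 'M[Mn]_(a, p)) i (j : 'I_p.+1) :
  (T *m bidiag F n p) i j =
  \sum_(l < p) (if j == l.+1 :> nat then 'X *: T i l
                else if j == l :> nat then - T i l else 0).
Proof.
rewrite mxE; apply: eq_bigr => l _; rewrite mxE.
case: ifP => _; first exact: mul_mx_scalar.
by case: ifP => _; rewrite ?mulrN1 ?mulr0.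
Qed.

Lemma coef_monomial_mul (f : R) (d s : nat) : (size f <= 2)%N ->
  ('X^d * f)`_s = (if s == d then f`_0 else 0) + (if s == d.+1 then f`_1 else 0).
Proof.
move=> sf; rewrite coefXnM; case: (ltngtP s d) => sd.
- by rewrite ifF ?addr0 //; lia.
- case: eqP => [->|sd']; first by rewrite subSnn add0r.
  by rewrite nth_default ?addr0 // (leq_trans sf) //; lia.
- by rewrite sd subnn ifF ?addr0 //; lia.
Qed.

(** Compare coefficients of lambda^s in [K *m Lambda_col = 0]. The leading coefficient of the first
    block column and the constant one of the last vanish. In between, the constant coefficient of
    each column is the opposite of the leading coefficient of the next, so the leading coefficients
    of the columns after the first form [N]. *)
Lemma wing_factor (p : nat) (K : 'M[Mn]_(p, p.+1)) : is_wing_pencil K ->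
  exists N : 'M['M[F]_n]_p, K = const_blocks N *m bidiag F n p.
Proof.
case=> /block_pencilP hK KL.
exists (\matrix_(i, l) coef_mx 1 (K i (lift ord0 l))).
have rel i a b s : \sum_(j < p.+1)
    ((if s == (p - j)%N then (K i j a b)`_0 else 0) +
     (if s == (p - j).+1 then (K i j a b)`_1 else 0)) = 0.
  have := congr1 (fun T : 'M[Mn]_(p, 1) => (T i ord0 a b)`_s) KL.
  rewrite !mxE coef0; apply: etrans; rewrite summxE coef_sum; apply: eq_bigr => j _.
  rewrite -coef_monomial_mul; last exact: hK.
  by rewrite [Lambda_col _ _ _ _ _]mxE -[_ * _%:M]/(_ *m _%:M) mul_mx_scalar mxE.
have top i : coef_mx 1 (K i ord0) = 0.
  apply/matrixP=> a b; rewrite !mxE /= -[RHS](rel i a b p.+1) (bigD1 ord0) //=.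
  rewrite subn0 eqxx ifF ?add0r ?big1 ?addr0 //; first by move=> j; rewrite -val_eqE /=;
    have := ltn_ord j => jp j0; rewrite !ifF ?addr0 //; lia.
  by lia.
have bot i : coef_mx 0 (K i ord_max) = 0.
  apply/matrixP=> a b; rewrite !mxE /= -[RHS](rel i a b 0%N) (bigD1 ord_max) //=.
  rewrite subnn /= addr0 big1 ?addr0 // => j; rewrite -val_eqE /=.
  by have := ltn_ord j => jp j0; rewrite ifF ?addr0 //; lia.
have mid i l :
    coef_mx 0 (K i (widen_ord (leqnSn p) l)) = - coef_mx 1 (K i (lift ord0 l)).
  apply/eqP; rewrite -addr_eq0; apply/eqP/matrixP=> a b; rewrite !mxE /=.
  have lp := ltn_ord l; rewrite -[RHS](rel i a b (p - l)%N).
  rewrite (bigD1 (widen_ord (leqnSn p) l)) //= (bigD1 (lift ord0 l)) /=; last first.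
    by rewrite -val_eqE /= /bump; lia.
  rewrite /bump leq0n add1n eqxx (_ : (p - l == (p - l).+1)%N = false); last by lia.
  rewrite (_ : (p - l == p - l.+1)%N = false); last by lia.
  rewrite (_ : (p - l == (p - l.+1).+1)%N); last by lia.
  rewrite addr0 add0r addrA big1 ?addr0 // => j /andP[].
  rewrite -!val_eqE /= /bump leq0n add1n => j1 j2; have jp := ltn_ord j.
  by rewrite !ifF ?addr0 //; lia.
apply/matrixP=> i j; rewrite mul_bidiag [LHS](pencil_decomp (hK i j)).
have split_sum (G H : 'I_p -> Mn) :
    \sum_(l < p) (if j == l.+1 :> nat then G l else if j == l :> nat then H l else 0) =
    \sum_(l < p | j == l.+1 :> nat) G l + \sum_(l < p | j == l :> nat) H l.
  rewrite [X in _ = X + _]big_mkcond [X in _ = _ + X]big_mkcond -big_split.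
  apply: eq_bigr => l _ /=; case: eqP => [jl|_]; last by rewrite add0r.
  by rewrite ifF ?addr0 //; lia.
rewrite split_sum; congr (_ + _).
  case: (unliftP ord0 j) => [l|] -> /=.
    rewrite (big_pred1 l) => [|l']; last by rewrite /= /bump eqSS eq_sym.
    by rewrite !mxE.
  by rewrite top raddf0 scaler0 big_pred0.
case: (unliftP ord_max j) => [l|] ->.
  rewrite (big_pred1 l) => [|l']; last by rewrite lift_max eq_sym.
  rewrite !mxE -raddfN -mid; congr (map_mx _ (coef_mx 0 (K i _))).
  by apply: val_inj; rewrite [LHS]lift_max.
rewrite bot raddf0 big_pred0 // => l.
by rewrite gtn_eqF.
Qed.

Lemma const_blocks_mul (a b c : nat) (G : 'M['M[F]_n]_(a, b)) (H : 'M['M[F]_n]_(b, c)) :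
  const_blocks (G *m H) = const_blocks G *m const_blocks H.
Proof.
apply/matrixP=> i j; rewrite !mxE raddf_sum; apply: eq_bigr => l _.
by rewrite !mxE; exact: map_mxM.
Qed.

Lemma const_blocks1 (a : nat) : const_blocks (1%:M : 'M['M[F]_n]_a) = 1%:M.
Proof.
apply/matrixP=> i j; rewrite !mxE; case: (i == j); last exact: raddf0.
exact: map_mx1.
Qed.

(** Independence of the rows of the product over the fraction field forces the square factor [N] to
    have full rank there. Its entries are constants and rank is preserved by field extension, so [N]
    is invertible already over [F]. *)
Lemma wing_unit (p : nat) (N : 'M['M[F]_n]_p) :
  is_minimal_basis (flatten_mx (const_blocks N *m bidiag F n p)) ->
  block_unit N /\ block_unit (const_blocks N).
Proof.
case=> + _; rewrite flatten_mul /frac_mx map_mxM => fr.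
have eN : flatten_mx (const_blocks N) = map_mx polyC (flatten_mx N).
  by apply/matrixP=> i j; rewrite [RHS]mxE !flatten_mxE !mxE.
have : row_free (map_mx (@tofrac _) (flatten_mx (const_blocks N))).
  rewrite -row_leq_rank; move: fr; rewrite -row_leq_rank => /leq_trans; apply.
  exact: mxrankM_maxl.
rewrite eN -map_mx_comp => fN.
have uN : flatten_mx N \in unitmx.
  by rewrite -row_free_unit -(row_free_map (@tofrac _ \o polyC)).
have bN : block_unit N by apply/block_unit_flatten.
split=> //; case: bN => N' [NN' _].
by apply: (proj1 (@block_unit_mul1 _ _ _ _ (const_blocks N') _));
  rewrite -const_blocks_mul NN' const_blocks1.
Qed.

(* Reversing the order of the block rows and block columns of the body turns
   the reversal of a block Kronecker pencil into a block Kronecker pencil. *)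
Lemma rev_wing (p : nat) (N : 'M['M[F]_n]_p) i j :
  rev_mx 1 ((const_blocks N *m bidiag F n p) i (rev_ord j)) =
  (const_blocks (- col_perm (perm (@rev_ord_inj p)) N) *m bidiag F n p) i j.
Proof.
rewrite !mul_bidiag.
have revD (A B : Mn) : rev_mx 1 (A + B) = rev_mx 1 A + rev_mx 1 B.
  apply/matrixP=> a b; rewrite !mxE; apply/polyP=> s.
  by rewrite coefD !coef_poly coefD; case: ifP => // _; rewrite addr0.
have rev0 : rev_mx 1 (0 : Mn) = 0.
  apply/matrixP=> a b; rewrite !mxE; apply/polyP=> s.
  by rewrite coef_poly !coef0 if_same.
rewrite (big_morph _ revD rev0) (reindex_inj rev_ord_inj) /=.
apply: eq_bigr => l _; rewrite !mxE permE.
have jp := ltn_ord j; have lp := ltn_ord l.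
have revX (A : 'M[F]_n) : rev_mx 1 ('X *: map_mx polyC A) = map_mx polyC A.
  apply/matrixP=> a b; rewrite !mxE; apply/polyP=> s.
  by rewrite coef_poly coefXM !coefC; case: s => [|[|s]] //=; rewrite coefC.
have revC (A : 'M[F]_n) : rev_mx 1 (map_mx polyC A) = 'X *: map_mx polyC A.
  apply/matrixP=> a b; rewrite !mxE; apply/polyP=> s.
  by rewrite coef_poly coefXM !coefC; case: s => [|[|s]] //=; rewrite coefC.
rewrite (_ : (p.+1 - j.+1 == (p - l.+1).+1)%N = (j == l :> nat)); last by lia.
rewrite (_ : (p.+1 - j.+1 == (p - l.+1))%N = (j == l.+1 :> nat)); last by lia.
case: (j =P l :> nat) => [jl|_].
  by rewrite (_ : (j == l.+1 :> nat) = false) ?revX ?raddfN ?opprK //; lia.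
case: ifP => _; last exact: rev0.
by rewrite -raddfN revC raddfN.
Qed.
End Pencils.

(** * Reversal of the body and strong linearization *)

Section StrongLinearization.
Variables (F : fieldType) (n : nat).
Local Notation R := {poly F}.
Local Notation Mn := 'M[R]_n.

Lemma coef_kron_body (p q : nat) (M : 'M[Mn]_(q.+1, p.+1)) (s : nat) :
  is_block_pencil M -> coef_mx s (kron_body M) =
  \sum_(i < q.+1) \sum_(j < p.+1)
    ((if s == (q - i + (p - j))%N then coef_mx 0 (M i j) else 0) +
     (if s == (q - i + (p - j)).+1 then coef_mx 1 (M i j) else 0)).
Proof.
move/block_pencilP=> hM; apply/matrixP=> a b; rewrite mxE /kron_body.
rewrite !summxE [coefp s]/coefp coef_sum; apply: eq_bigr => i _.
rewrite !summxE coef_sum; apply: eq_bigr => j _.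
rewrite !mxE mulrA -exprD coef_monomial_mul; last exact: hM.
by congr (_ + _); case: ifP => _; rewrite !mxE.
Qed.

(** With indices counted from 1, block (i, j) of the body is multiplied by lambda^(k + 1 - i - j),
    so the two antidiagonals in [AS M s] are those that contribute to lambda^s. *)
Lemma AS_of_body (p q : nat) (M : 'M[Mn]_(q.+1, p.+1)) :
  is_block_pencil M -> AS_condition M (kron_body M).
Proof.
move=> hM s sk; rewrite coef_kron_body // /AS -big_split; apply: eq_bigr => i _ /=.
rewrite [X in X + _ = _]big_mkcond [X in _ + X = _]big_mkcond -big_split.
have iq := ltn_ord i; apply: eq_bigr => j _ /=; have jp := ltn_ord j.
by rewrite addrC; congr (_ + _); congr (if _ then _ else _); lia.
Qed.

Lemma coef_rev1 (A : Mn) :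
  (coef_mx 0 (rev_mx 1 A) = coef_mx 1 A) * (coef_mx 1 (rev_mx 1 A) = coef_mx 0 A).
Proof. by split; apply/matrixP=> a b; rewrite !mxE /= coef_poly. Qed.

Lemma has_grade_rev1 (a b : nat) (A : 'M[R]_(a, b)) : has_grade 1 (rev_mx 1 A).
Proof. by move=> i j; rewrite mxE; exact: size_poly. Qed.

(** Reversing the block order replaces an exponent [e] by [p + q - e], and reversing the blocks
    replaces a degree [d] by [1 - d]; together, a term of degree [s] goes to degree
    [p + q + 1 - s]. *)
Lemma kron_body_rev (p q : nat) (M : 'M[Mn]_(q.+1, p.+1)) : is_block_pencil M ->
  kron_body (\matrix_(i, j) rev_mx 1 (M (rev_ord i) (rev_ord j))) =
  rev_mx (p + q + 1) (kron_body M).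
Proof.
move=> hM; apply/matrixP=> a b; rewrite [RHS]mxE; apply/polyP=> s.
have hM' : is_block_pencil
    (\matrix_(i < q.+1, j < p.+1) rev_mx 1 (M (rev_ord i) (rev_ord j))).
  by apply/block_pencilP=> i j; rewrite mxE; exact: has_grade_rev1.
have -> : (kron_body (\matrix_(i < q.+1, j < p.+1)
    rev_mx 1 (M (rev_ord i) (rev_ord j))) a b)`_s =
  coef_mx s (kron_body (\matrix_(i < q.+1, j < p.+1)
    rev_mx 1 (M (rev_ord i) (rev_ord j)))) a b by rewrite mxE.
rewrite coef_poly coef_kron_body //.
have -> : (kron_body M a b)`_(p + q + 1 - s) =
  coef_mx (p + q + 1 - s) (kron_body M) a b by rewrite mxE.
rewrite coef_kron_body // (reindex_inj rev_ord_inj) /=.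
have [sk|sk] := ltnP s (p + q + 1).+1; last first.
  rewrite summxE big1 // => i _; rewrite summxE big1 // => j _.
  by rewrite !ifF ?addr0 ?mxE //; lia.
congr (fun_of_matrix _ a b); apply: eq_bigr => i _.
rewrite (reindex_inj rev_ord_inj); apply: eq_bigr => j _.
rewrite !mxE !rev_ordK !coef_rev1 addrC /=; have := ltn_ord i;
  have := ltn_ord j => jp iq.
by congr (_ + _); congr (if _ then _ else _); lia.
Qed.

Lemma linearization_of_equiv (K : nat) (L : 'M[Mn]_K.+1) (P : Mn) :
  is_block_pencil L ->
  block_equiv L (diag_last K P) ->
  is_linearization (flatten_mx L) P.
Proof. by move=> hL /flatten_equiv_diag. Qed.

Lemma kron_strong_linearization (K p q : nat) (L : 'M[Mn]_K.+1)
    (er : K.+1 = (q.+1 + p)%N) (ec : K.+1 = (p.+1 + q)%N)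
    (M : 'M[Mn]_(q.+1, p.+1)) (K1 : 'M[Mn]_(p, p.+1)) (K2 : 'M[Mn]_(q, q.+1)) :
  is_block_pencil L -> is_ext_block_kronecker (castmx (er, ec) L) M K1 K2 ->
  is_minimal_basis (flatten_mx K1) -> is_minimal_basis (flatten_mx K2) ->
  is_strong_linearization K.+1 (flatten_mx L) (kron_body M).
Proof.
move=> hL [eL hM /wing_factor[N1 e1] /wing_factor[N2 e2]].
rewrite e1 e2 => /wing_unit[u1 cu1] /wing_unit[u2 cu2].
have eL' : L = castmx (esym er, esym ec) (castmx (er, ec) L).
  by rewrite castmx_comp castmx_id.
split.
  apply: linearization_of_equiv => //; rewrite eL' eL e1 e2.
  exact: kron_linearization.
pose rev_bl a b (H : 'M[Mn]_(a, b)) := map_mx (fun A : Mn => rev_mx 1 A) H.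
have -> : rev_mx 1 (flatten_mx L) = flatten_mx (rev_bl _ _ L).
  by apply/matrixP=> i j; rewrite [LHS]mxE !flatten_mxE !mxE.
have -> : rev_mx K.+1 (kron_body M) = rev_mx (p + q + 1) (kron_body M).
  by have -> : (p + q + 1 = K.+1)%N by lia.
apply: linearization_of_equiv.
  by apply/block_pencilP=> i j; rewrite mxE; exact: has_grade_rev1.
rewrite -kron_body_rev //.
pose M' : 'M[Mn]_(q.+1, p.+1) := \matrix_(i, j) rev_mx 1 (M (rev_ord i) (rev_ord j)).
(* By [rev_wing], a reversed wing has the same form, with [N] negated and its block columns
   reversed; invertibility is preserved. *)
have urev m (N : 'M['M[F]_n]_m) : block_unit N ->
    block_unit (const_blocks (- col_perm (perm (@rev_ord_inj m)) N)).
  case=> N' [NN' _].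
  apply: (proj1 (@block_unit_mul1 _ _ _ _
    (const_blocks (- row_perm (perm (@rev_ord_inj m)) N')) _)).
  rewrite -const_blocks_mul mulmxN mulNmx opprK row_permE col_permE.
  by rewrite -mulmxA (mulmxA (perm_mx _)) -perm_mxM mulVg perm_mx1 mul1mx NN'
    const_blocks1.
have := kron_linearization (esym er) (esym ec) M' (urev _ _ u1) (urev _ _ u2).
apply: block_equiv_trans; rewrite [L in rev_bl _ _ L]eL'.
have -> : rev_bl _ _ (castmx (esym er, esym ec) (castmx (er, ec) L)) =
    castmx (esym er, esym ec) (rev_bl _ _ (castmx (er, ec) L)).
  by rewrite /rev_bl map_castmx.
apply: block_equiv_cast; rewrite eL /rev_bl.
pose J m := perm (@rev_ord_inj m).
(* The reversals act on the rows and columns of the body, hence also on the columns of [K1] and the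
   rows of the transposed [K2]; the remaining rows and columns stay in place. *)
exists (block_mx (perm_mx (J q.+1)) 0 0 1%:M), (block_mx (perm_mx (J p.+1)) 0 0 1%:M).
have u1M m : block_unit (1%:M : 'M[Mn]_m) by exists 1%:M; rewrite mulmx1.
split; try by apply: block_unit_diag => //; exact: block_unit_perm.
have JV m : (J m)^-1%g = J m.
  by apply/permP=> i; apply: (@perm_inj _ (J m)); rewrite permKV !permE rev_ordK.
rewrite map_block_mx !mulmx_block !mulmx0 !mul0mx !addr0 !add0r !mul1mx !mulmx1 ?mul0mx.
congr block_mx; apply/matrixP=> i j.
- by rewrite -[J p.+1]JV -col_permE -row_permE !mxE /J !permE.
- rewrite -row_permE [LHS]mxE [LHS]mxE permE [RHS]mxE -rev_wing -e2 [full_tr _ _ _]mxE.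
  by apply/matrixP=> a b; rewrite !mxE.
- by rewrite -[J p.+1]JV -col_permE [LHS]mxE [LHS]mxE permE e1 rev_wing.
- rewrite !mxE; apply/matrixP=> a b; rewrite !mxE; apply/polyP=> s.
  by rewrite coef_poly !coef0 if_same.
Qed.
End StrongLinearization.

(** * GFPRs *)

Lemma SIP_rev (t : seq int) : SIP t -> SIP (rev t).
Proof.
have nthr c : (c < size t)%N -> (rev t)`_c = t`_(size t - c.+1) by exact: nth_rev.
move=> sip a b /andP[ab]; rewrite size_rev => bt; rewrite !nthr //;
  last exact: ltn_trans bt.
move=> e; case: (sip (size t - b.+1)%N (size t - a.+1)%N) => [|//|c [/andP[c1 c2] ec]].
  by lia.
exists (size t - c.+1)%N; split; first by lia.
rewrite nthr; last by lia.
by rewrite e -ec; congr nth; lia.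
Qed.

Section SIPWords.
Variable f : nat -> int.
Hypotheses (fS : forall j, f j.+1 = f j + 1) (f_inj : injective f).

(** Apply the SIP to the displayed [i] and its next occurrence, the first one in [t2]. The map [f]
    stands for either the inclusion of the naturals or the shift by -k. *)
Lemma SIP_before (t1 t2 : seq nat) (i : nat) :
  SIP (map f (t1 ++ i :: t2)) -> i \in t2 -> before t2 i.+1 i.
Proof.
move=> sip it2; have lt := it2; rewrite -index_mem in lt.
have nthS m : nth 0%N (t1 ++ i :: t2) (size t1 + m.+1) = nth 0%N t2 m.
  by rewrite nth_cat ltnNge leq_addr /= addKn.
have szE m : (size t1 + m.+1 < size (t1 ++ i :: t2))%N = (m < size t2)%N.
  by rewrite size_cat /= ltn_add2l.
have sz0 : (size t1 < size (t1 ++ i :: t2))%N.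
  by rewrite size_cat /= addnS ltnS leq_addr.
case: (sip (size t1) (size t1 + (index i t2).+1)%N).
- by rewrite size_map szE lt addnS ltnS leq_addr.
- by rewrite !(nth_map 0%N) ?szE // nthS nth_cat ltnn subnn /= nth_index.
move=> c [/andP[c1 c2]].
have [m em] : exists m, c = (size t1 + m.+1)%N by exists (c - (size t1).+1)%N; lia.
have mi : (m < index i t2)%N by move: c2; rewrite em ltn_add2l ltnS.
rewrite em !(nth_map 0%N) ?szE ?(ltn_trans mi lt) //.
rewrite nthS nth_cat ltnn subnn /= -fS => /f_inj e.
rewrite /before -e; apply: leq_ltn_trans mi; rewrite leqNgt; apply/negP.
by move/(before_find 0%N); rewrite /= eqxx.
Qed.

Lemma SIP_before_rev (t1 t2 : seq nat) (i : nat) :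
  SIP (map f (t1 ++ i :: t2)) -> i \in t1 -> before (rev t1) i.+1 i.
Proof.
move=> /SIP_rev; rewrite -map_rev rev_cat rev_cons -cats1 -catA /= => /SIP_before.
by rewrite mem_rev.
Qed.
End SIPWords.

(** * Elementary matrices of both signs as modified transpositions *)

Section ElementaryMatrices.
Variables (F : fieldType) (n K : nat).
Local Notation k := K.+1.

(** The position of the block B in M_j(B), and for [pos_z] in M_(j - k)(B). In both cases index [j]
    acts on the positions of [j] and [j - 1], and the last indices [h] and [K - h] share the
    position [K - h]. *)
Definition pos_q (j : nat) : 'I_k := inord (K - j).
Definition pos_z (j : nat) : 'I_k := inord j.

Lemma core1_swap (a : 'I_k) (B : 'M[F]_n) :
  core1 k a B = swap_mx a a (B - 1) :> 'M['M[F]_n]_k.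
Proof.
apply/matrixP=> i j; rewrite !mxE tperm1 perm1; case: (i =P j) => [->|/eqP ij].
  by rewrite andbb val_eqE; case: ifP => _; rewrite ?addr0 // addrC subrK.
case: (i =P a) ij => [->|_ _]; last by rewrite addr0.
by rewrite eq_sym => /negPf->; rewrite addr0.
Qed.

Lemma core2_swap_l (a b : 'I_k) (B : 'M[F]_n) : b = a.+1 :> nat ->
  core2 k a B 1%:M 1%:M 0 = swap_mx a b B :> 'M['M[F]_n]_k.
Proof.
move=> ab; apply/matrixP=> i j; rewrite !mxE -!ab !val_eqE.
have nab : (a == b) = false by apply/eqP => e; move: ab; rewrite e; lia.
case: tpermP => [->|->|/eqP/negPf ja /eqP/negPf jb].
- rewrite eqxx nab !andbT !andbF; case: (i =P a) => [->|_].
    by rewrite nab add0r.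
  by case: (i =P b); rewrite ?addr0.
- rewrite eqxx (eq_sym b a) nab !andbT !andbF addr0.
  by case: (i =P a) => // _; case: (i =P b).
- by rewrite ja jb !andbF addr0; case: (i =P j).
Qed.

Lemma core2_swap_r (a b : 'I_k) (B : 'M[F]_n) : b = a.+1 :> nat ->
  core2 k a 0 1%:M 1%:M B = swap_mx b a B :> 'M['M[F]_n]_k.
Proof.
move=> ab; apply/matrixP=> i j; rewrite !mxE -!ab !val_eqE.
have nab : (a == b) = false by apply/eqP => e; move: ab; rewrite e; lia.
case: tpermP => [->|->|/eqP/negPf jb /eqP/negPf ja].
- rewrite eqxx (eq_sym b a) nab !andbT !andbF; case: (i =P a) => [->|_].
    by rewrite nab addr0.
  by case: (i =P b); rewrite ?add0r.
- rewrite eqxx nab !andbT !andbF addr0.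
  by case: (i =P a) => [->|_] //; rewrite ?nab //; case: (i =P b).
- by rewrite ja jb !andbF addr0; case: (i =P j).
Qed.

(* Replacing B by B - 1 for j = 0 makes up for swap_mx a a C = 1 + C e_a e_a^T. *)
Lemma elem_mx_q (j : nat) (B : 'M[F]_n) : (j <= K)%N ->
  elem_mx k j%:Z B = swap_mx (pos_q j) (pos_q j.-1) (B - (j == 0%N)%:R).
Proof.
move=> jK; rewrite /elem_mx; case: j jK => [|j] jK.
  by rewrite /= -core1_swap /pos_q inordK ?subn0.
have -> : (j.+1%:Z == 0) = false by [].
have -> : (j.+1%:Z == - k%:Z) = false by lia.
have -> : 0 < j.+1%:Z by [].
rewrite subr0 -core2_swap_l /pos_q !inordK //; try lia.
by congr core2; lia.
Qed.

Lemma elem_mx_z (j : nat) (B : 'M[F]_n) : (j <= K)%N ->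
  elem_mx k (j%:Z - k%:Z) B = swap_mx (pos_z j) (pos_z j.-1) (B - (j == 0%N)%:R).
Proof.
move=> jK; rewrite /elem_mx.
have -> : (j%:Z - k%:Z == 0) = false by lia.
case: j jK => [|j] jK.
  by rewrite sub0r !eqxx /= -core1_swap /pos_z inordK.
have -> : (j.+1%:Z - k%:Z == - k%:Z) = false by lia.
have -> : (0 < j.+1%:Z - k%:Z) = false by lia.
rewrite subr0 -core2_swap_r /pos_z !inordK //; try lia.
by congr core2; lia.
Qed.

Lemma const_swap (a b : 'I_k) (C : 'M[F]_n) :
  const_blocks (swap_mx a b C) = swap_mx a b (map_mx polyC C).
Proof.
apply/matrixP=> i j; rewrite !mxE raddfD /=; congr (_ + _).
  by case: (_ == _); [exact: map_mx1 | exact: raddf0].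
by case: ifP => _ //; exact: raddf0.
Qed.

Lemma const_prod (I : Type) (r : seq I) (G : I -> 'M['M[F]_n]_k) :
  const_blocks (\prod_(i <- r) G i) = \prod_(i <- r) const_blocks (G i).
Proof.
elim: r => [|x r IH]; first by rewrite !big_nil const_blocks1.
by rewrite !big_cons -IH; exact: const_blocks_mul.
Qed.

Definition word_of (t : seq nat) (X : seq 'M[F]_n) : seq (nat * 'M[{poly F}]_n) :=
  [seq (x.1, map_mx polyC (x.2 - (x.1 == 0%N)%:R)) | x <- zip t X].

Lemma unzip1_word (t : seq nat) (X : seq 'M[F]_n) :
  size X = size t -> unzip1 (word_of t X) = t.
Proof. by move=> e; rewrite /unzip1 -map_comp; apply: unzip1_zip; rewrite e. Qed.

Lemma const_tuple_mx (o : nat -> 'I_k) (f : nat -> int) (t : seq nat)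
    (X : seq 'M[F]_n) :
  (forall (j : nat) (B : 'M[F]_n), (j <= K)%N ->
     elem_mx k (f j) B = swap_mx (o j) (o j.-1) (B - (j == 0%N)%:R)) ->
  all (fun j => j <= K)%N t ->
  const_blocks (tuple_mx k (map f t) X) = word_mx o (word_of t X).
Proof.
move=> fE; rewrite /tuple_mx const_prod /word_mx big_map.
elim: t X => [|j t IH] [|B X] /=; rewrite ?big_nil //.
by case/andP=> jK tK; rewrite !big_cons fE // const_swap IH.
Qed.
End ElementaryMatrices.

(** * Selected rows, columns and exponents of the Fiedler pencil *)

Section BaseForm.
Variables (F : fieldType) (n K h : nat).
Hypothesis hK : (h <= K)%N.
Local Notation k := K.+1.
Local Notation R := {poly F}.
Local Notation Mn := 'M[R]_n.

(** Positions smaller than [K - h] follow z, larger ones follow q, and the shared position is always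
    selected. *)
Definition selection (sz sq : nat -> bool) (i : nat) : bool :=
  if (i < K - h)%N then sz i else if i == (K - h)%N then true else sq (K - i)%N.

Definition nb_from (sel : nat -> bool) (i : nat) : nat := count sel (iota i (k - i)).

(** The exponent is the number of selected positions that follow, so the exponents fill an initial
    segment of the naturals without repetition. *)
Definition label (sel : nat -> bool) (i : 'I_k) : option nat :=
  if sel i then Some (nb_from sel i.+1) else None.

Lemma nb_fromS (sel : nat -> bool) i : (i <= K)%N ->
  nb_from sel i = (sel i + nb_from sel i.+1)%N.
Proof. by move=> iK; rewrite /nb_from subSS subSn. Qed.

Lemma selection_q sz sq j : (j < h)%N -> selection sz sq (K - j) = sq j.
Proof.
move=> jh; rewrite /selection ltn_sub2lE ?(leq_trans (ltnW jh)) // ltnNge (ltnW jh).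
rewrite eqn_sub2lE ?(leq_trans (ltnW jh)) // ltn_eqF // subKn //.
exact: leq_trans (ltnW jh) hK.
Qed.

Lemma selection_z sz sq j : (j < K - h)%N -> selection sz sq j = sz j.
Proof. by rewrite /selection => ->. Qed.

Lemma selection_h sz sq : selection sz sq (K - h).
Proof. by rewrite /selection ltnn eqxx. Qed.

Lemma val_pos_q j : pos_q K j = (K - j)%N :> nat.
Proof. by rewrite /pos_q inordK // ltnS leq_subr. Qed.

Lemma val_pos_z j : (j <= K)%N -> pos_z K j = j :> nat.
Proof. by move=> jK; rewrite /pos_z inordK. Qed.

Lemma pos_q_inj : {in gtn h.+1 &, injective (pos_q K)}.
Proof.
move=> i j; rewrite !inE => ih jh /(congr1 val); rewrite /= !val_pos_q; lia.
Qed.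

Lemma pos_z_inj : {in gtn (K - h).+1 &, injective (pos_z K)}.
Proof.
move=> i j; rewrite !inE => ih jh /(congr1 val); rewrite /= !val_pos_z; lia.
Qed.

Lemma mem_range_q i : (i \in index_range (pos_q K) h) = (K - h < i)%N.
Proof.
apply/mapP/idP=> [[j]|hi].
  by rewrite mem_iota => jh ->; rewrite val_pos_q; lia.
exists (K - i)%N; first by rewrite mem_iota; have := ltn_ord i; lia.
by apply: val_inj; rewrite /= val_pos_q; have := ltn_ord i; lia.
Qed.

Lemma mem_range_z i : (i \in index_range (pos_z K) (K - h)) = (i < K - h)%N.
Proof.
apply/mapP/idP=> [[j]|hi].
  by rewrite mem_iota => jh ->; rewrite val_pos_z; lia.
exists (i : nat); first by rewrite mem_iota.
by apply: val_inj; rewrite /= val_pos_z //; lia.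
Qed.

Lemma factor_diag_qz i :
  factor_diag (pos_q K) ('X : R) 1 h i = factor_diag (pos_z K) 1 'X (K - h) i.
Proof.
rewrite /factor_diag mem_range_q mem_range_z.
have -> : (i == pos_q K h) = (i == K - h :> nat)%N by rewrite -val_eqE /= val_pos_q.
by case: ltngtP.
Qed.

Section Signs.
Variables (con_q con_z : nat -> bool).
Let rsel := selection con_z con_q.
Let csel := selection (fun j => ~~ con_z j) (fun j => ~~ con_q j).

(** Each position larger than [K - h] is selected in exactly one of rows and columns. *)
Lemma nb_from_low s : (s <= h)%N ->
  (nb_from rsel (K - s).+1 + nb_from csel (K - s).+1 = s)%N.
Proof.
elim: s => [_|s IH sh]; first by rewrite subn0 /nb_from subnn.
have -> : (K - s.+1).+1 = (K - s)%N by lia.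
rewrite (nb_fromS rsel (leq_subr s K)) (nb_fromS csel (leq_subr s K)).
have {IH} := IH (ltnW sh).
rewrite /rsel /csel !selection_q // -/rsel -/csel.
by case: (con_q s); lia.
Qed.

Lemma nb_from_gt0 j : (j <= K - h)%N ->
  (0 < nb_from rsel j)%N && (0 < nb_from csel j)%N.
Proof.
move=> jh; rewrite /nb_from -!has_count; apply/andP; split; apply/hasP;
  exists (K - h)%N; try exact: selection_h; rewrite mem_iota; lia.
Qed.

(** As before, but the shared position is selected twice and therefore contributes one more than the
    others. *)
Lemma nb_from_high j : (j <= K - h)%N ->
  (nb_from rsel j + nb_from csel j = (K - j).+2)%N.
Proof.
move=> jh; have jK : (j <= K)%N by lia.
have [m em] : exists m, m = (K - h - j)%N by exists (K - h - j)%N.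
elim: m j jh jK em => [|m IH] j jh jK em.
  have -> : j = (K - h)%N by lia.
  rewrite (nb_fromS rsel (leq_subr h K)) (nb_fromS csel (leq_subr h K)).
  rewrite /rsel /csel !selection_h -/rsel -/csel.
  by have := nb_from_low (leqnn h); lia.
have jh' : (j.+1 <= K - h)%N by lia.
have jK' : (j.+1 <= K)%N by lia.
have e' : m = (K - h - j.+1)%N by lia.
rewrite (nb_fromS rsel jK) (nb_fromS csel jK); have := IH j.+1 jh' jK' e'.
rewrite /rsel /csel !selection_z // -/rsel -/csel.
by case: (con_z j); lia.
Qed.

(** Weights grow by lambda along the indices of q, where [al] is lambda and [be] is 1, and shrink
    along those of z, where the roles are exchanged; they agree at the shared position, so a single
    pair of labellings serves both factors. *)
Lemma base_form (Cq Cz : nat -> Mn) :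
  labelled_form
    (factor_pencil (pos_q K) 'X 1 Cq con_q h
      - factor_pencil (pos_z K) 1 'X Cz con_z (K - h))
    (label rsel) (label csel)
    (\sum_(j < h.+1) - 'X^j *: (Cq j + (j == 0%N :> nat)%:R) +
     \sum_(j < (K - h).+1) 'X^(k - j) *: (Cz j + (j == 0%N :> nat)%:R)).
Proof.
have lab_q sel j : (j <= h)%N ->
    (isSome \o label sel) (pos_q K j) = sel (K - j)%N /\
    (@monomial F \o label sel) (pos_q K j) =
      if sel (K - j)%N then 'X^(nb_from sel (K - j).+1) else 0.
  by move=> jh; rewrite /= /label val_pos_q; case: (sel _).
have lab_z sel j : (j <= K - h)%N ->
    (isSome \o label sel) (pos_z K j) = sel j /\
    (@monomial F \o label sel) (pos_z K j) =
      if sel j then 'X^((nb_from sel j).-1) else 0.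
  move=> jh; rewrite /= /label val_pos_z; last by lia.
  have -> : nb_from sel j = (sel j + nb_from sel j.+1)%N by apply: nb_fromS; lia.
  by case: (sel _).
apply: kron_formD.
  have -> : \sum_(j < h.+1) - 'X^j *: (Cq j + (j == 0%N :> nat)%:R) =
      \sum_(j < h.+1) - (1 * ('X^(nb_from rsel (K - j).+1) *
        'X^(nb_from csel (K - j).+1))) *: (Cq j + (j == 0%N :> nat)%:R).
    by apply: eq_bigr => j _; rewrite -exprD nb_from_low ?mul1r // -ltnS.
  apply: (@kron_form_factor _ _ _ _ _ _ Cq con_q h _ _ _ _
    (fun j => 'X^(nb_from rsel (K - j).+1)) (fun j => 'X^(nb_from csel (K - j).+1))).
  - exact: pos_q_inj.
  - move=> j jh; rewrite (_ : (K - j.+1).+1 = K - j)%N; last by lia.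
    rewrite (nb_fromS rsel (leq_subr j K)) (nb_fromS csel (leq_subr j K)).
    rewrite /rsel /csel !selection_q // !mul1r.
    by case: (con_q j); rewrite /= ?add0n ?add1n ?exprS.
  - move=> j jh; have [-> _] := lab_q rsel j (ltnW jh).
    by have [-> _] := lab_q csel j (ltnW jh); rewrite /rsel /csel !selection_q.
  - move=> j jh; have [_ ->] := lab_q rsel j (ltnW jh).
    have [_ ->] := lab_q csel j (ltnW jh).
    by rewrite /rsel /csel !selection_q //; case: (con_q j).
  - have [-> ->] := lab_q rsel h (leqnn h); have [-> ->] := lab_q csel h (leqnn h).
    by rewrite /rsel /csel !selection_h.
rewrite -[X in kron_form _ _ _ _ _ X]opprK; apply: kron_formN.
(* [nb_from] at [j] includes position [j] itself; its predecessor is the exponent that the position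
   has when it is selected. The two predecessors and the factor lambda of the z part turn
   [K - j + 2] into [k - j]. *)
have -> : - (\sum_(j < (K - h).+1) 'X^(k - j) *: (Cz j + (j == 0%N :> nat)%:R)) =
    \sum_(j < (K - h).+1) - ('X * ('X^((nb_from rsel j).-1) * 'X^((nb_from csel j).-1)))
      *: (Cz j + (j == 0%N :> nat)%:R).
  rewrite -sumrN; apply: eq_bigr => j _; rewrite -exprD -exprS scaleNr.
  have jh : (j <= K - h)%N by rewrite -ltnS.
  have /andP[] := nb_from_gt0 jh; have := nb_from_high jh => e g1 g2.
  by congr (- ('X^_ *: _)); lia.
apply: (@kron_form_factor _ _ _ _ _ _ Cz con_z (K - h) _ _ _ _
  (fun j => 'X^((nb_from rsel j).-1)) (fun j => 'X^((nb_from csel j).-1))).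
- exact: pos_z_inj.
- move=> j jh; have /andP[] := nb_from_gt0 jh => g1 g2.
  have jK : (j <= K)%N by lia.
  have /andP[] := nb_from_gt0 (j := j.+1) jh => g1' g2'.
  rewrite (nb_fromS rsel jK) (nb_fromS csel jK).
  rewrite /rsel /csel !selection_z // !mul1r.
  by case: (con_z j); rewrite /= ?add0n ?add1n -exprS prednK.
- move=> j jh; have [-> _] := lab_z rsel j (ltnW jh).
  by have [-> _] := lab_z csel j (ltnW jh); rewrite /rsel /csel !selection_z.
- move=> j jh; have [_ ->] := lab_z rsel j (ltnW jh).
  have [_ ->] := lab_z csel j (ltnW jh).
  by rewrite /rsel /csel !selection_z //; case: (con_z j).
- have [-> ->] := lab_z rsel _ (leqnn _); have [-> ->] := lab_z csel _ (leqnn _).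
  by rewrite /rsel /csel !selection_h.
Qed.
End Signs.
End BaseForm.

Lemma label_codom (K : nat) (sel : nat -> bool) :
  perm_eq (codom (@label K sel))
    (map Some (iota 0 (nb_from K sel 0)) ++ nseq (K.+1 - nb_from K sel 0) None).
Proof.
have gen a N : perm_eq
    [seq (if sel i then Some (count sel (iota i.+1 (a + N - i.+1))) else None)
       | i <- iota a N]
    (map Some (iota 0 (count sel (iota a N))) ++ nseq (N - count sel (iota a N)) None).
  elim: N a => [|N IH] a //=.
  rewrite addnS subSS addKn; set c := count sel (iota a.+1 N).
  have cN : (c <= N)%N by rewrite (leq_trans (count_size _ _)) ?size_iota.
  have := IH a.+1; rewrite addSn -/c => IHa.
  case: (sel a).
    have -> : iota 0 (true + c) = iota 0 c ++ [:: c] by rewrite addnC iotaD.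
    rewrite map_cat -catA subSS perm_sym.
    by rewrite (perm_catCA _ [:: Some c]) perm_cons perm_sym.
  rewrite add0n subSn // perm_sym -[nseq _.+1 _]/([:: None] ++ nseq (N - c) None).
  by rewrite (perm_catCA _ [:: None]) perm_cons perm_sym.
have := gen 0%N K.+1; rewrite /nb_from subn0; apply: perm_trans.
rewrite -val_enum_ord -map_comp codomE.
by rewrite (_ : map _ _ = map (label sel) (enum 'I_K.+1)) //; apply: eq_map.
Qed.

(** * From labels to the block Kronecker form *)

Section BlockKroneckerForm.
Variables (F : fieldType) (n : nat).
Local Notation R := {poly F}.
Local Notation Mn := 'M[R]_n.

Lemma block_permE (k : nat) (s t : 'S_k) (L : 'M[Mn]_k) i j :
  ((block_perm R n s)^T *m L *m block_perm R n t) i j = L (s i) (t j).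
Proof.
have -> : (block_perm R n s)^T = perm_mx s.
  by apply/matrixP=> a b; rewrite !mxE eq_sym.
have -> : block_perm R n t = perm_mx t^-1.
  apply/matrixP=> a b; rewrite !mxE.
  by rewrite -[in RHS](inj_eq (@perm_inj _ t)) permKV.
by rewrite -col_permE -row_permE !mxE.
Qed.

(** The exponents of Lambda_p in order, followed by unselected positions. *)
Definition target_label (p j : nat) : option nat :=
  if (j <= p)%N then Some (p - j)%N else None.

Lemma perm_target (k p q : nat) (cl : 'I_k -> option nat) : k = (p.+1 + q)%N ->
  perm_eq (codom cl) (map Some (iota 0 p.+1) ++ nseq q None) ->
  exists s : 'S_k, forall j, cl (s j) = target_label p j.
Proof.
move=> ek pc.
have eT : [seq target_label p j | j : 'I_k] = [seq target_label p j | j <- iota 0 k].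
  by rewrite -val_enum_ord -map_comp.
have pT : perm_eq [seq target_label p j | j : 'I_k] [tuple cl i | i < k].
  have eC : tval [tuple cl i | i < k] = codom cl by rewrite codomE.
  rewrite eT [X in perm_eq _ X]eC.
  rewrite perm_sym; apply: perm_trans pc _.
  rewrite ek iotaD map_cat add0n; apply: perm_cat.
    have -> : [seq target_label p i | i <- iota 0 p.+1] = map Some (rev (iota 0 p.+1)).
      apply: (@eq_from_nth _ None); first by rewrite !size_map size_rev.
      move=> i; rewrite size_map size_iota => ip.
      rewrite (nth_map 0%N) ?size_iota // (nth_map 0%N) ?size_rev ?size_iota //.
      rewrite nth_rev ?size_iota // !nth_iota //; last by lia.
      by rewrite /target_label !add0n -ltnS ip subSS.
    by apply: perm_map; rewrite perm_sym perm_rev.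
  suff -> : [seq target_label p i | i <- iota p.+1 q] = nseq q None by [].
  apply: (@eq_from_nth _ None); first by rewrite !size_map size_nseq size_iota.
  move=> i; rewrite size_map size_iota => iq.
  rewrite (nth_map 0%N) ?size_iota // nth_iota // nth_nseq iq /target_label ifF //.
  by lia.
have [s es] := tuple_permP pT; exists s => j.
have := congr1 (fun t => nth None t j) es.
rewrite (nth_map j) ?size_enum_ord // nth_ord_enum => ->.
by rewrite -tnth_nth !tnth_mktuple.
Qed.

Lemma sum_cast_split (V : nmodType) (k a b : nat) (e : k = (a + b)%N) (f : 'I_k -> V) :
  \sum_i f i = \sum_(i < a) f (cast_ord (esym e) (lshift b i)) +
               \sum_(i < b) f (cast_ord (esym e) (rshift a i)).
Proof.
subst k; rewrite big_split_ord.
by congr (_ + _); apply: eq_bigr => i _; rewrite cast_ord_id.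
Qed.

(** Once both labellings are sorted, the conditions on unselected rows and columns become the wing
    equations of [K1] and [K2], the vanishing condition gives the zero block, and the value is
    [kron_body M]. *)
Lemma labelled_form_kronecker (k p q : nat) (L : 'M[Mn]_k) rl cl (Q : Mn)
    (er : k = (q.+1 + p)%N) (ec : k = (p.+1 + q)%N) :
  is_block_pencil L -> labelled_form L rl cl Q ->
  perm_eq (codom rl) (map Some (iota 0 q.+1) ++ nseq p None) ->
  perm_eq (codom cl) (map Some (iota 0 p.+1) ++ nseq q None) ->
  exists sr sc : 'S_k,
    let L' := (block_perm R n sr)^T *m L *m block_perm R n sc in
    exists (M : 'M[Mn]_(q.+1, p.+1)) (K1 : 'M[Mn]_(p, p.+1)) (K2 : 'M[Mn]_(q, q.+1)),
      [/\ is_ext_block_kronecker (castmx (er, ec) L') M K1 K2,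
          is_block_pencil L' & kron_body M = Q].
Proof.
move=> /block_pencilP hL [h1 h2 h3 h4].
move=> /(perm_target er)[sr esr] /(perm_target ec)[sc esc].
exists sr, sc => L'; have L'E i j : L' i j = L (sr i) (sc j) by exact: block_permE.
pose C := castmx (er, ec) L'.
have CE i j : C i j = L (sr (cast_ord (esym er) i)) (sc (cast_ord (esym ec) j)).
  by rewrite castmxE L'E.
have rlU i : rl (sr (cast_ord (esym er) (lshift p i))) = Some (q - i)%N.
  by rewrite esr /target_label /= -ltnS ltn_ord.
have rlD i : rl (sr (cast_ord (esym er) (rshift q.+1 i))) = None.
  by rewrite esr /target_label /= ifF //; lia.
have clU i : cl (sc (cast_ord (esym ec) (lshift q i))) = Some (p - i)%N.
  by rewrite esc /target_label /= -ltnS ltn_ord.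
have clD i : cl (sc (cast_ord (esym ec) (rshift p.+1 i))) = None.
  by rewrite esc /target_label /= ifF //; lia.
have hC i j : has_grade 1 (C i j) by rewrite CE; exact: hL.
exists (ulsubmx C), (dlsubmx C), (full_tr (ursubmx C)); split.
- split.
  + rewrite full_trK -[castmx _ _]/C -{1}[C]submxK; congr block_mx.
    by apply/matrixP=> i j; rewrite !mxE CE h3 //= ?rlD ?clD.
  + by apply/block_pencilP=> i j; rewrite !mxE; exact: hC.
  + split; first by apply/block_pencilP=> i j; rewrite !mxE; exact: hC.
    apply/matrixP=> i j; rewrite [RHS]mxE mxE.
    have := h1 (sr (cast_ord (esym er) (rshift q.+1 i))).
    rewrite /= rlD => /(_ isT); apply: etrans.
    rewrite (reindex_inj (@perm_inj _ sc)) (sum_cast_split ec) /=.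
    rewrite [X in _ = _ + X]big1 ?addr0; last by move=> l _; rewrite clD scale0r.
    apply: eq_bigr => l _; rewrite clU !mxE CE.
    exact: mul_mx_scalar.
  + split.
      by apply/block_pencilP=> i j a b; rewrite !mxE; exact: hC.
    apply/matrixP=> i j; rewrite [RHS]mxE mxE.
    have := h2 (sc (cast_ord (esym ec) (rshift p.+1 i))).
    rewrite /= clD => /(_ isT) H; apply: (can_inj (@trmxK _ _ _)); rewrite trmx0.
    apply: etrans H.
    rewrite (reindex_inj (@perm_inj _ sr)) (sum_cast_split er) /=.
    rewrite [X in _ = _ + X]big1 ?addr0; last by move=> l _; rewrite rlD scale0r.
    rewrite raddf_sum; apply: eq_bigr => l _; rewrite rlU !mxE CE.
    rewrite -[_ * _%:M]/(_ *m _%:M) mul_mx_scalar /=.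
    by rewrite -linearZ trmxK.
- by apply/block_pencilP=> i j; rewrite L'E; exact: hL.
rewrite -h4 (reindex_inj (@perm_inj _ sr)) (sum_cast_split er) /=.
rewrite [X in _ = _ + X]big1 ?addr0; last first.
  by move=> l _; rewrite big1 // => m _; rewrite rlD scale0r.
apply: eq_bigr => i _; rewrite (reindex_inj (@perm_inj _ sc)) (sum_cast_split ec) /=.
rewrite [X in _ = _ + X]big1 ?addr0; last by move=> l _; rewrite clD scale0r scaler0.
by apply: eq_bigr => j _; rewrite rlU clU !mxE CE.
Qed.
End BlockKroneckerForm.

Lemma before_cat (T : eqType) (s t : seq T) (x y : T) :
  y \in s -> before (s ++ t) x y = before s x y.
Proof.
move=> ys; rewrite /before !index_cat ys; case: ifP => // /negbT xs.
rewrite (memNindex xs); have := ys; rewrite -index_mem => lt.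
by rewrite !ltnNge (ltnW lt) (leq_trans (ltnW lt)) ?leq_addr.
Qed.

Section WordsOfOneSign.
Variable f : nat -> int.
Hypotheses (fS : forall j, f j.+1 = f j + 1) (f_inj : injective f).
Variables (h : nat) (l t r : seq nat).
Hypotheses (pt : perm_eq t (iota 0 h.+1)) (lh : {subset l <= iota 0 h})
  (rh : {subset r <= iota 0 h}) (sip : SIP (map f (l ++ t ++ r))).

Lemma SIP_right r1 i r2 : r = r1 ++ i :: r2 ->
  (i < h)%N /\ before (rev r1 ++ rev t) i.+1 i.
Proof.
move=> er; have ih : (i < h)%N.
  by have := rh (x := i); rewrite er mem_cat inE eqxx orbT mem_iota => /(_ isT).
have it : i \in t by rewrite (perm_mem pt) mem_iota; lia.
split=> //; have := @SIP_before_rev f fS f_inj (l ++ t ++ r1) r2 i.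
rewrite -!catA /= -er => /(_ sip); rewrite !mem_cat it orbT => /(_ isT).
by rewrite !rev_cat -catA catA before_cat // mem_cat !mem_rev it orbT.
Qed.

Lemma SIP_left l1 i l2 : l = l1 ++ i :: l2 ->
  (i < h)%N /\ before (l2 ++ t) i.+1 i.
Proof.
move=> el; have ih : (i < h)%N.
  by have := lh (x := i); rewrite el mem_cat inE eqxx orbT mem_iota => /(_ isT).
have it : i \in t by rewrite (perm_mem pt) mem_iota; lia.
split=> //; have := @SIP_before f fS f_inj l1 (l2 ++ t ++ r) i.
have -> : l1 ++ i :: l2 ++ t ++ r = l ++ t ++ r by rewrite el -catA.
move=> /(_ sip); rewrite !mem_cat it orbT => /(_ isT).
by rewrite catA before_cat // mem_cat it orbT.
Qed.
End WordsOfOneSign.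

Lemma colonD (a : int) (m : nat) :
  colon a (a + m%:Z - 1) = [seq a + j%:Z | j <- iota 0 m].
Proof.
rewrite /colon; case: m => [|m]; first by rewrite ifF //; lia.
rewrite ifT; last by lia.
by rewrite (_ : `|(a + m.+1%:Z - 1 - a)%R|%N = m) //; lia.
Qed.

Lemma subset_map_preim (f : nat -> int) (s : seq nat) (t : seq int) :
  {subset t <= map f s} -> exists2 u, t = map f u & {subset u <= s}.
Proof.
elim: t => [|x t IH] sub; first by exists [::].
have [|u -> us] := IH; first by move=> y yt; apply: sub; rewrite inE yt orbT.
have /mapP[j js ->] : x \in map f s by apply: sub; rewrite inE eqxx.
by exists (j :: u) => // y; rewrite inE => /predU1P[->|/us].
Qed.

Lemma count_selection (K h : nat) (sz sq : nat -> bool) : (h <= K)%N ->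
  nb_from K (selection K h sz sq) 0 =
  (count sq (iota 0 h) + count sz (iota 0 (K - h))).+1.
Proof.
move=> hK; set sel := selection K h sz sq.
have low s : (s <= h)%N -> nb_from K sel (K - s).+1 = count sq (iota 0 s).
  elim: s => [|s IH] sh; first by rewrite subn0 /nb_from subnn.
  have -> : (K - s.+1).+1 = (K - s)%N by lia.
  rewrite nb_fromS ?leq_subr // IH ?(ltnW sh) // /sel selection_q //.
  have -> : iota 0 s.+1 = iota 0 s ++ [:: s] by rewrite -addn1 iotaD.
  by rewrite count_cat /= addn0 addnC.
have high m : (m <= K - h)%N ->
    nb_from K sel (K - h - m) =
    (count sq (iota 0 h) + count sz (iota (K - h - m) m)).+1.
  elim: m => [|m IH] mh.
    by rewrite subn0 nb_fromS ?leq_subr // low // /sel selection_h /= addn0 add1n.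
  rewrite nb_fromS; last by lia.
  have -> : (K - h - m.+1).+1 = (K - h - m)%N by lia.
  rewrite IH ?(ltnW mh) // /sel selection_z; last by lia.
  rewrite /= (_ : (K - h - m.+1).+1 = (K - h - m)%N); last by lia.
  by rewrite addnS addnCA.
by have := high _ (leqnn _); rewrite subnn.
Qed.

Lemma poly_mx_sum (F : fieldType) (n k : nat) (P : 'M[{poly F}]_n) : has_grade k P ->
  P = \sum_(s < k.+1) 'X^s *: map_mx polyC (coef_mx s P).
Proof.
move=> hP; apply/matrixP=> i j; rewrite summxE.
under eq_bigr do rewrite !mxE mulrC mul_polyC.
rewrite -poly_def; apply/polyP=> s; rewrite coef_poly; case: ltnP => // ks.
by rewrite nth_default // (leq_trans (hP i j)).
Qed.

Section Pencil.
Variables (F : fieldType) (n K h : nat) (P : 'M[{poly F}]_n).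
Hypotheses (hK : (h <= K)%N) (hP : has_grade K.+1 P).
Let Cq j := map_mx polyC (- coef_mx j P - (j == 0%N)%:R).
Let Cz j := map_mx polyC (coef_mx (K.+1 - j) P - (j == 0%N)%:R).

Lemma fiedler_pencil_sum :
  \sum_(j < h.+1) - 'X^j *: (Cq j + (j == 0%N :> nat)%:R) +
  \sum_(j < (K - h).+1) 'X^(K.+1 - j) *: (Cz j + (j == 0%N :> nat)%:R) = P.
Proof.
have addC (A : 'M[F]_n) (b : bool) :
    map_mx polyC (A - b%:R) + b%:R = map_mx polyC A :> 'M[{poly F}]_n.
  have -> : b%:R = map_mx polyC b%:R :> 'M[{poly F}]_n.
    by case: b; [rewrite [RHS]map_mx1 | rewrite [RHS]raddf0].
  by rewrite -raddfD subrK.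
rewrite [RHS](poly_mx_sum hP).
have -> : \sum_(s < K.+2) 'X^s *: map_mx polyC (coef_mx s P) =
    \sum_(s < h.+1 + (K - h).+1) 'X^s *: map_mx polyC (coef_mx s P).
  by rewrite (_ : (h.+1 + (K - h).+1)%N = K.+2) //; lia.
rewrite big_split_ord; congr (_ + _).
  apply: eq_bigr => j _; rewrite addC raddfN scalerN scaleNr opprK.
  by [].
rewrite [RHS](reindex_inj rev_ord_inj); apply: eq_bigr => j _; rewrite addC /=.
have -> : (h.+1 + ((K - h).+1 - j.+1))%N = (K.+1 - j)%N by have := ltn_ord j; lia.
by [].
Qed.
Variables (q z : seq nat).
Hypotheses (pq : perm_eq q (iota 0 h.+1)) (pz : perm_eq z (iota 0 (K - h).+1)).
Let con_q j := before q j j.+1.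
Let con_z j := before z j j.+1.

Lemma fiedler_pencilE :
  'X%:M *: const_blocks (tuple_mxP K.+1 P [seq - K.+1%:Z + j%:Z | j <- z])
    - const_blocks (tuple_mxP K.+1 P (map Posz q)) =
  factor_pencil (pos_q K) 'X 1 Cq con_q h
    - factor_pencil (pos_z K) 1 'X Cz con_z (K - h).
Proof.
have eq : const_blocks (tuple_mxP K.+1 P (map Posz q)) =
    fiedler_mx (pos_q K) Cq con_q h.
  rewrite -prod_fiedler //; last exact: pos_q_inj.
  rewrite /tuple_mxP const_prod big_map; apply: eq_big_seq => j jq.
  have jK : (j <= K)%N by move: jq; rewrite (perm_mem pq) mem_iota; lia.
  by rewrite /elem_mxP elem_mx_q // const_swap.
have ez : const_blocks (tuple_mxP K.+1 P [seq - K.+1%:Z + j%:Z | j <- z]) =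
    fiedler_mx (pos_z K) Cz con_z (K - h).
  rewrite -prod_fiedler //; last exact: pos_z_inj.
  rewrite /tuple_mxP const_prod big_map; apply: eq_big_seq => j jz.
  have jK : (j <= K)%N by move: jz; rewrite (perm_mem pz) mem_iota; lia.
  rewrite /elem_mxP addrC elem_mx_z // const_swap ifF; last by lia.
  by rewrite (_ : `|(j%:Z - K.+1%:Z)%R|%N = (K.+1 - j)%N) //; lia.
rewrite eq ez; apply/matrixP=> i j; rewrite !mxE.
rewrite -factor_diag_qz // scale1r opprB [RHS]addrC addrA subrK.
by congr (_ - _); exact: mul_scalar_mx.
Qed.

End Pencil.

Section GFPR.
Variables (F : fieldType) (n : nat).
Local Notation R := {poly F}.

Lemma has_grade_mul (c d a b m : nat) (G : 'M[R]_(a, b)) (H : 'M[R]_(b, m)) :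
  has_grade c G -> has_grade d H -> has_grade (c + d) (G *m H).
Proof.
move=> hG hH i j; rewrite mxE; apply: (leq_trans (size_sum _ _ _)).
apply/bigmax_leqP => l _; apply: (leq_trans (size_polyMleq _ _)).
by rewrite -subn1 leq_subLR add1n -addSn -addnS leq_add ?hG ?hH.
Qed.

Lemma block_pencil_const_mul (a b c d : nat) (G : 'M['M[F]_n]_(a, b))
    (H : 'M['M[R]_n]_(b, c)) (G' : 'M['M[F]_n]_(c, d)) :
  is_block_pencil H -> is_block_pencil (const_blocks G *m H *m const_blocks G').
Proof.
have hc a' b' (T : 'M['M[F]_n]_(a', b')) : has_grade 0 (flatten_mx (const_blocks T)).
  by move=> i j; rewrite flatten_mxE !mxE size_polyC leq_b1.
move=> hH; rewrite /is_block_pencil !flatten_mul.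
exact: (has_grade_mul (c := 1) (has_grade_mul (hc _ _ G) hH) (hc _ _ G')).
Qed.

Lemma block_pencil_affine (a b : nat) (A B : 'M['M[F]_n]_(a, b)) :
  is_block_pencil ('X%:M *: const_blocks A - const_blocks B).
Proof.
apply/block_pencilP=> i j x y.
have -> : ('X%:M *: const_blocks A - const_blocks B) i j =
    'X *: map_mx polyC (A i j) - map_mx polyC (B i j).
  by rewrite !mxE; congr (_ - _); exact: mul_scalar_mx.
rewrite !mxE.
rewrite (leq_trans (size_polyD _ _)) // geq_max size_polyN size_polyC.
rewrite (leq_trans (leq_b1 _)) // andbT mulrC mul_polyC.
by rewrite (leq_trans (size_scale_leq _ _)) // size_polyX.
Qed.

Lemma size_codom_label (K p : nat) (sel : nat -> bool) :
  nb_from K sel 0 = p.+1 -> 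
  perm_eq (codom (@label K sel)) (map Some (iota 0 p.+1) ++ nseq (K - p) None).
Proof. by move=> e; have := label_codom K sel; rewrite e subSS. Qed.

(** Words of z act on positions smaller than [K - h] and words of q on larger ones, so the four
    words are absorbed one by one and labels on one side survive words of the other side. The
    initial accumulators are z and q: in the base form column j is unselected when j precedes j + 1,
    and row j is unselected otherwise. *)
Lemma gfpr_labelled_form (K h : nat) (P : 'M[R]_n) (q z lq rq lz rz : seq nat)
    (X Y Z W : seq 'M[F]_n) (fz := fun j : nat => - K.+1%:Z + j%:Z) :
  (h <= K)%N -> has_grade K.+1 P ->
  perm_eq q (iota 0 h.+1) -> perm_eq z (iota 0 (K - h).+1) ->
  {subset lq <= iota 0 h} -> {subset rq <= iota 0 h} ->
  {subset lz <= iota 0 (K - h)} -> {subset rz <= iota 0 (K - h)} ->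
  SIP (map Posz (lq ++ q ++ rq)) -> SIP (map fz (lz ++ z ++ rz)) ->
  size X = size lq -> size Y = size rq -> size Z = size lz -> size W = size rz ->
  let sel sq sz := @label K (selection K h sz sq) in
  exists rl cl,
    [/\ labelled_form (gfpr K.+1 P (map Posz lq) (map fz lz) (map fz z) (map Posz q)
           (map fz rz) (map Posz rq) X Z W Y) rl cl P,
        perm_eq (codom rl) (codom (sel (fun j => before q j j.+1)
                                       (fun j => before z j j.+1))) &
        perm_eq (codom cl) (codom (sel (fun j => ~~ before q j j.+1)
                                       (fun j => ~~ before z j j.+1)))].
Proof.
move=> hK hP pq pz hlq hrq hlz hrz sipq sipz sX sY sZ sW sel.
have Pz_inj : injective Posz by move=> x y [].
have fz_inj : injective fz by move=> x y /addrI[].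
have PzS j : Posz j.+1 = Posz j + 1 by lia.
have fzS j : fz j.+1 = fz j + 1 by rewrite /fz; lia.
have base := base_form hK (fun j => before q j j.+1) (fun j => before z j j.+1)
  (fun j => map_mx polyC (- coef_mx j P - (j == 0%N)%:R))
  (fun j => map_mx polyC (coef_mx (K.+1 - j) P - (j == 0%N)%:R)).
rewrite (fiedler_pencil_sum hK hP) -(fiedler_pencilE P hK pq pz) in base.
have Uq : uniq q by rewrite (perm_uniq pq) iota_uniq.
have Uz : uniq z by rewrite (perm_uniq pz) iota_uniq.
have inq j : (j <= h)%N -> j \in q by move=> jh; rewrite (perm_mem pq) mem_iota; lia.
have inz j : (j <= K - h)%N -> j \in z.
  by move=> jh; rewrite (perm_mem pz) mem_iota; lia.
have z_out (j : nat) : (j < h)%N -> pos_q K j \notin index_range (pos_z K) (K - h).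
  by move=> jh; rewrite mem_range_z // -leqNgt val_pos_q; lia.
have all_le s m : (m <= K)%N -> {subset s <= iota 0 m} -> all (fun j => j <= K)%N s.
  by move=> mK sub; apply/allP => j /sub; rewrite mem_iota; lia.
have lab_q (s : nat -> bool) (t : nat -> bool) j : (j < h)%N -> ~~ t j ->
    sel t s (pos_q K j) = None.
  move=> jh /negPf tj; rewrite /sel /label val_pos_q //.
  by rewrite selection_q // tj.
have lab_z (s : nat -> bool) (t : nat -> bool) j : (j < K - h)%N -> ~~ s j ->
    sel t s (pos_z K j) = None.
  move=> jh /negPf tj; rewrite /sel /label val_pos_z; last by lia.
  by rewrite selection_z // tj.
set rl0 := label _ in base; set cl0 := label _ in base.
have [|r1 i r2|cl1 [L1 pc1 oc1]] := labelled_form_mul_word (o := pos_z K) (h := K - h)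
  (acc := rev z) (r := word_of rz W) (@pos_z_inj K h hK) _ _ base.
- move=> j jh; rewrite before_rev ?inz //; try lia; move=> bj.
  by apply: lab_z; rewrite ?negbK.
- rewrite unzip1_word // => e.
  exact: (SIP_right fzS fz_inj pz hrz sipz e).
have [|r1 i r2|cl2 [L2 pc2 _]] := labelled_form_mul_word (o := pos_q K) (h := h)
  (acc := rev q) (r := word_of rq Y) (@pos_q_inj K h hK) _ _ L1.
- move=> j jh; rewrite before_rev ?inq //; try lia; move=> bj.
  by rewrite oc1 ?z_out //; apply: lab_q; rewrite ?negbK.
- rewrite unzip1_word // => e.
  exact: (SIP_right PzS Pz_inj pq hrq sipq e).
have [|l1 i l2|rl1 [L3 pr1 or1]] := labelled_form_word_mul (o := pos_z K) (h := K - h)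
  (acc := z) (l := word_of lz Z) (@pos_z_inj K h hK) _ _ L2.
- move=> j jh; rewrite beforeN ?inz //; try lia; move=> bj.
  exact: lab_z.
- rewrite unzip1_word // => e.
  exact: (SIP_left fzS fz_inj pz hlz sipz e).
have [|l1 i l2|rl2 [L4 pr2 _]] := labelled_form_word_mul (o := pos_q K) (h := h)
  (acc := q) (l := word_of lq X) (@pos_q_inj K h hK) _ _ L3.
- move=> j jh; rewrite beforeN ?inq //; try lia; move=> bj.
  by rewrite or1 ?z_out //; apply: lab_q.
- rewrite unzip1_word // => e.
  exact: (SIP_left PzS Pz_inj pq hlq sipq e).
exists rl2, cl2; split; first 1 last.
- exact: perm_trans pr2 pr1.
- exact: perm_trans pc2 pc1.
have fzE j (B : 'M[F]_n) : (j <= K)%N ->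
    elem_mx K.+1 (fz j) B = swap_mx (pos_z K j) (pos_z K j.-1) (B - (j == 0%N)%:R).
  by rewrite /fz addrC; exact: elem_mx_z.
have eq_word t (V : seq 'M[F]_n) : {subset t <= iota 0 h} ->
    const_blocks (tuple_mx K.+1 (map Posz t) V) = word_mx (pos_q K) (word_of t V).
  move=> ht; apply: const_tuple_mx; first exact: elem_mx_q.
  exact: all_le hK ht.
have ez_word t (V : seq 'M[F]_n) : {subset t <= iota 0 (K - h)} ->
    const_blocks (tuple_mx K.+1 (map fz t) V) = word_mx (pos_z K) (word_of t V).
  move=> ht; apply: const_tuple_mx; first exact: fzE.
  exact: all_le (leq_subr h K) ht.
rewrite /gfpr !const_blocks_mul (eq_word _ X hlq) (eq_word _ Y hrq).
rewrite (ez_word _ Z hlz) (ez_word _ W hrz).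
by move: L4; rewrite !mulmxA.
Qed.
End GFPR.

Theorem theorem8p1 (F : fieldType) (k n : nat) (hk : (2 <= k)%N)
    (P : 'M[{poly F}]_n) (hP : has_grade k P)
    (h : nat) (hh : (h <= k - 1)%N)
    (q z lq rq lz rz : seq int)
    (hq : perm_eq q (colon 0 h%:Z))
    (hz : perm_eq z (colon (- k%:Z) (- h%:Z - 1)))
    (hlq : {subset lq <= colon 0 (h%:Z - 1)})
    (hrq : {subset rq <= colon 0 (h%:Z - 1)})
    (hSIPq : SIP (lq ++ q ++ rq))
    (hlz : {subset lz <= colon (- k%:Z) (- h%:Z - 2)})
    (hrz : {subset rz <= colon (- k%:Z) (- h%:Z - 2)})
    (hSIPz : SIP (lz ++ z ++ rz))
    (X Y Z W : seq 'M[F]_n)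
    (hX : size X = size lq) (hY : size Y = size rq)
    (hZ : size Z = size lz) (hW : size W = size rz) :
  let L := gfpr k P lq lz z q rz rq X Z W Y in
  let kz := shift_tuple k%:Z z in
  let p' := (nb_strings q + nb_strings kz - 2)%N in
  let q' := (nb_strings (rev q) + nb_strings (rev kz) - 2)%N in
  exists (cl cr : 'S_k),
    let L' := (block_perm {poly F} n cl)^T *m L *m block_perm {poly F} n cr in
    exists (er : k = (q'.+1 + p')%N) (ec : k = (p'.+1 + q')%N)
           (M : 'M['M[{poly F}]_n]_(q'.+1, p'.+1))
           (K1 : 'M['M[{poly F}]_n]_(p', p'.+1))
           (K2 : 'M['M[{poly F}]_n]_(q', q'.+1)),
      [/\ is_ext_block_kronecker (castmx (er, ec) L') M K1 K2,
          AS_condition M P &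
          is_minimal_basis (flatten_mx K1) ->
          is_minimal_basis (flatten_mx K2) ->
          is_strong_linearization k (flatten_mx L') P].
Proof.
case: k hk hP hh hz hlz hrz => [//|K] _ hP; rewrite subSS subn0 => hK hz hlz hrz.
have Pz_inj : injective Posz by move=> x y [].
(* Writing z as a shift of natural numbers lets both tuples be treated as permutations of an initial
   segment, of lengths [h.+1] and [(K - h).+1]. *)
pose fz (j : nat) : int := - K.+1%:Z + j%:Z.
have fz_inj : injective fz by move=> x y /addrI[].
have colon_q m (x : int) : x = m%:Z - 1 -> colon 0 x = map Posz (iota 0 m).
  move=> ->; rewrite -[m%:Z in LHS]add0r colonD; apply: eq_map => j.
  exact: add0r.
have colon_z m (x : int) : x = - K.+1%:Z + m%:Z - 1 ->
    colon (- K.+1%:Z) x = map fz (iota 0 m) by move=> ->; exact: colonD.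
rewrite (colon_q h.+1) in hq; last by lia.
rewrite (colon_q h) // in hlq hrq.
rewrite (colon_z (K - h).+1) in hz; last by lia.
rewrite (colon_z (K - h)%N) in hlz hrz; [|lia..].
have [|qn eq _] := @subset_map_preim Posz (iota 0 h.+1) q.
  by move=> x; rewrite (perm_mem hq).
have [|zn ez _] := @subset_map_preim fz (iota 0 (K - h).+1) z.
  by move=> x; rewrite (perm_mem hz).
have [lqn elq slq] := subset_map_preim hlq; have [rqn erq srq] := subset_map_preim hrq.
have [lzn elz slz] := subset_map_preim hlz; have [rzn erz srz] := subset_map_preim hrz.
subst q z lq rq lz rz.
have pq : perm_eq qn (iota 0 h.+1) by apply: perm_map_inj hq.
have pz : perm_eq zn (iota 0 (K - h).+1) by apply: perm_map_inj hz.
have kzE : shift_tuple K.+1%:Z (map fz zn) = map Posz zn.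
  by rewrite /shift_tuple -map_comp; apply: eq_map => j; rewrite /= /fz addNKr.
rewrite !size_map in hX hY hZ hW.
rewrite -!map_cat in hSIPq hSIPz.
move=> L kz p' q'.
have cnt m t : perm_eq t (iota 0 m.+1) ->
    count (fun j => ~~ before t j j.+1) (iota 0 m) = ndesc m t.
  move=> pt; apply: eq_in_count => j; rewrite mem_iota => jm.
  by rewrite -beforeN ?(perm_mem pt) ?mem_iota; lia.
(* Each of the two tuples has one string more than descents, which accounts for the 2 subtracted in
   the sizes. *)
have ep : p' = (ndesc h qn + ndesc (K - h) zn)%N.
  by rewrite /p' /kz kzE (nb_stringsE pq) (nb_stringsE pz); lia.
have eq' : q' = (nasc h qn + nasc (K - h) zn)%N.
  rewrite /q' /kz kzE -!map_rev (nb_stringsE (h := h)) ?(nb_stringsE (h := K - h)%N).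
  - by rewrite !ndesc_rev //; lia.
  - by rewrite perm_rev.
  - by rewrite perm_rev.
(* Each consecutive pair is an ascent or a descent; summed over the two tuples this gives
   [p' + q' = h + (K - h)], so that the block dimensions fit. *)
have asc_desc m t : perm_eq t (iota 0 m.+1) -> (nasc m t + ndesc m t = m)%N.
  by move=> /cnt <-; rewrite count_predC size_iota.
have [eq1 ez1] := (asc_desc _ _ pq, asc_desc _ _ pz).
have epq : K = (p' + q')%N by rewrite ep eq'; lia.
have [rl [cl [Lf pr pc]]] := gfpr_labelled_form hK hP pq pz slq srq slz srz
  hSIPq hSIPz hX hY hZ hW.
have hL : is_block_pencil L.
  by apply: block_pencil_const_mul; exact: block_pencil_affine.
have er : K.+1 = (q'.+1 + p')%N by lia.
have ec : K.+1 = (p'.+1 + q')%N by lia.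
have pr' : perm_eq (codom rl) (map Some (iota 0 q'.+1) ++ nseq p' None).
  apply: perm_trans pr _; rewrite [p' in nseq p' _](_ : _ = K - q')%N; last by lia.
  by apply: size_codom_label; rewrite count_selection // eq'.
have pc' : perm_eq (codom cl) (map Some (iota 0 p'.+1) ++ nseq q' None).
  apply: perm_trans pc _; rewrite [q' in nseq q' _](_ : _ = K - p')%N; last by lia.
  by apply: size_codom_label; rewrite count_selection // !cnt // ep.
have [sr [sc [M [K1 [K2 [kron hL' body]]]]]] :=
  labelled_form_kronecker er ec hL Lf pr' pc'.
exists sr, sc => L'; exists er, ec, M, K1, K2; split=> //.
  by rewrite -body; apply: AS_of_body; case: kron.
by move=> m1 m2; rewrite -body; apply: kron_strong_linearization kron m1 m2.
Qed.
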